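(* Let $N\ge 1$, let $X\in\{A,B\}$ (for $X=B$ fix also $m\ge1$), and take the sign $\epsilon=-$. For all $\alpha,\gamma\in\mathcal P_N=\{1,2\}^N$, $$\sum_{\beta\in\mathcal P_N} Q^{X,I,-}_{\alpha,\beta}\,Q^{X,II,-}_{\beta,\gamma}\,(-1)^{|\beta|+|\gamma|}=\delta_{\alpha,\gamma}.$$
   Context: Case A: $t,t_N$ are algebraically independent. Case B: $t_N=t^m$ with a fixed $m\in\mathbb{N}_+$. Paths and diagrams ($\epsilon=-$). $\mathcal P_N=\{1,2\}^N$. A string $\alpha$ is identified with the lattice path starting at $(0,0)$ whose $i$-th step is $(1,-1)$ if $\alpha_i=1$ and $(1,1)$ if $\alpha_i=2$. Write $\alpha\le\beta$ if every prefix of $\alpha$ contains at least as many $1$'s as the prefix of $\beta$ of the same length, i.e. the path $\alpha$ lies weakly below the path $\beta$. A box $(i,j)$ is the 45-degree rotated square centred at $(i,j)$ with vertices $(i\pm1,j),(i,j\pm1)$. $\lambda^-(\alpha)$ is the set of boxes $(i,j)$ with $0<i\le N$, $|j|\le i$, $i+j-1$ even and $(i,j)$ below the path $\alpha$; $|\alpha|$ is its number of boxes. For $\alpha\le\beta$ the region $\lambda^-(\beta)/\lambda^-(\alpha)$ consists of the boxes between the two paths. A box $(N,j)$ of the region is an anchor box. For a box $(x,y)$, the box $(x+1,y+1)$ is NE of it, $(x-1,y+1)$ is NW of it, and $(x,y+2)$, $(x,y-2)$ are just above and just below it. Ballot strips. A ballot path of length $(l,l')\in\mathbb N^2$ is a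 path with steps $(1,\pm1)$ from some $(x,y)$ to $(x+2l+l',y+l')$ staying weakly above the horizontal line at height $y$. A ballot strip of length $(l,l')$ is the set of boxes centred at the vertices of a ballot path of length $(l,l')$ (a single box has length $(0,0)$). A configuration in $\mathrm{Conf}(\alpha,\beta)$ is a partition of the boxes of the region into ballot strips satisfying Rule 0: the rightmost box of a ballot strip of length $(l,l')$ with $l'\ge1$ is an anchor box. Rule I. (a) (Cases A and B) for strips $\mathcal D,\mathcal D'$: if some box of $\mathcal D$ is just below a box of $\mathcal D'$, then all boxes just below a box of $\mathcal D'$ belong to $\mathcal D$. (b) (Case B only) for each $(l,l')$ with $l'\ge m$, the number of ballot strips of length $(l,l')$ is even if $l'-m$ is even, and zero otherwise. Rule II. (a) (Cases A and B) for strips $\mathcal D,\mathcal D'$: if some box of $\mathcal D'$ is just above, NW or NE of a box of $\mathcal D$, then all boxes just above, NW and NE of a box of $\mathcal D$ belong to $\mathcal D$ or $\mathcal D'$ (positions with first coordinate $>N$ are disregarded). (b) (Case B only) if there is a ballot strip $\mathcal D$ of length $(l,l')$ with $l'\ge m$ and $l'-m$ even (resp. odd), then there is a strip of length $(l'',l'+1)$ with $l''\ge l$ just above $\mathcal D$ (resp. of length $(l'',l'-1)$ with $l''\le l$ just below $\mathcal D$). $\mathrm{Conf}^{Y}(\alpha,\beta)$, $Y\in\{I,II\}$, is the set of configurations satisfying Rule $Y$ (with part (b) only in Case B). Weights of a strip $\mathcal D$ of length $(l,l')$, with $\sigma=+1$ for Rule I and $\sigma=-1$ for Rule II: $\mathrm{wt}^A(\mathcal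 D)=t^{2l+l'}$ if $l'$ is even, $-\sigma t^{2l+l'-1}t_N^2$ if $l'$ is odd; $\mathrm{wt}^B(\mathcal D)=\sigma^{l'}t^{2l+2l'}$ if $0\le l'\le m-1$, $t^{m+l'+2l}$ if $l'\ge m$ and $l'-m$ even, $t^{m+l'+2l-1}$ if $l'\ge m$ and $l'-m$ odd. Generating function: $Q^{X,Y,-}_{\alpha,\beta}=\sum_{\mathcal C\in\mathrm{Conf}^Y(\alpha,\beta)}\prod_{\mathcal D\in\mathcal C}\mathrm{wt}^X(\mathcal D)$ for $\alpha\le\beta$ (so $Q^{X,Y,-}_{\alpha,\alpha}=1$), and $Q^{X,Y,-}_{\alpha,\beta}=0$ if $\alpha\not\le\beta$. *)

(* Defs.v *)
From mathcomp Require Import all_boot all_order all_algebra.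
From mathcomp Require Import zify.
Set Implicit Arguments.
Unset Strict Implicit.
Unset Printing Implicit Defensive.
Import Order.TTheory GRing.Theory Num.Theory.
Local Open Scope ring_scope.

(* The letters 1 and 2 of a string are encoded as false and true. *)
Definition letter1 : bool := false.
Definition letter2 : bool := true.

Definition word (N : nat) := N.-tuple bool.

(* Second coordinate of the lattice path of s after k steps. *)
Definition height (s : seq bool) (k : nat) : int :=
  (count_mem letter2 (take k s))%:Z - (count_mem letter1 (take k s))%:Z.

Definition path_le (N : nat) (a b : word N) : bool :=
  [forall k : 'I_N.+1,
     count_mem letter1 (take k b) <= count_mem letter1 (take k a)]%N.

(* A finite carrier for the boxes with centre (x, y), 0 < x <= N and
   -N <= y <= N: the pair (i, j) encodes the centre (i + 1, j - N). *)
Definition box (N : nat) := ('I_N * 'I_N.*2.+1)%type.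

Definition column (N : nat) (b : box N) : nat := b.1.+1.
Definition level (N : nat) (b : box N) : int := (b.2 : nat)%:Z - N%:Z.
Definition centre (N : nat) (b : box N) : int * int :=
  ((column b)%:Z, level b).

Definition is_anchor (N : nat) (b : box N) : bool := column b == N.

(* Positions range over all of Z x Z, so that the rules can refer to positions
   that are not boxes of the region; such a position lies in no strip. *)
Definition has_pos (N : nat) (D : {set box N}) (p : int * int) : bool :=
  p \in [seq centre b | b in D].

Definition above (p : int * int) : int * int := (p.1, p.2 + 2).
Definition below (p : int * int) : int * int := (p.1, p.2 - 2).
Definition NE (p : int * int) : int * int := (p.1 + 1, p.2 + 1).
Definition NW (p : int * int) : int * int := (p.1 - 1, p.2 + 1).

(* As x + y is odd, the centre of a box lies below the path exactly when the
   whole box does. *)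
Definition diagram (N : nat) (a : word N) : {set box N} :=
  [set b : box N | [&& `|level b| <= (column b)%:Z,
                       (2 %| (column b)%:Z + level b - 1)%Z
                     & level b < height a (column b)]].

Definition region (N : nat) (a b : word N) : {set box N} :=
  diagram b :\: diagram a.

Definition is_ballot (l l' : nat) (w : seq bool) : bool :=
  [&& size w == (l.*2 + l')%N,
      height w (l.*2 + l') == l'%:Z
    & [forall k : 'I_(l.*2 + l').+1, 0 <= height w k]].

Definition path_pos (p : int * int) (w : seq bool) (k : nat) : int * int :=
  (p.1 + k%:Z, p.2 + height w k).

Definition is_strip_of (N l l' : nat) (D : {set box N}) : bool :=
  [exists b0 : box N, exists w : (l.*2 + l').-tuple bool,
    [&& is_ballot l l' w,
        [forall k : 'I_(l.*2 + l').+1, has_pos D (path_pos (centre b0) w k)]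
      & [forall b in D, exists k : 'I_(l.*2 + l').+1,
           centre b == path_pos (centre b0) w k]]].

(* A strip has 2l + l' + 1 boxes in distinct columns, so l, l' < N. *)
Definition is_strip (N : nat) (D : {set box N}) : bool :=
  [exists l : 'I_N, exists l' : 'I_N, is_strip_of l l' D].

(* The length (l, l') of a strip, which is unique (see strip_lengthP), with
   the junk value (0, 0) on sets that are not strips. *)
Definition strip_length (N : nat) (D : {set box N}) : nat * nat :=
  if [pick p : 'I_N * 'I_N | is_strip_of p.1 p.2 D] is Some p
  then (p.1 : nat, p.2 : nat) else (0, 0)%N.

Lemma is_strip_of_uniq N l l' k k' (D : {set box N}) :
  is_strip_of l l' D -> is_strip_of k k' D -> l = k /\ l' = k'.
Proof.
wlog: l l' k k' / (l.*2 + l' <= k.*2 + k')%N.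
  move=> H; case: (leqP (l.*2 + l') (k.*2 + k')) => [/H //|/ltnW le2 D1 D2].
  by have [-> ->] := H _ _ _ _ le2 D2 D1.
move=> le_lk /existsP[b0 /existsP[w /and3P[/and3P[_ /eqP hw _] /forallP wD]]].
move/forall_inP=> Dw /existsP[c0 /existsP[v /and3P[/and3P[_ /eqP hv _]]]].
move=> /forallP vD /forall_inP Dv.
have start (u : seq bool) : height u 0 = 0 by rewrite /height take0 subrr.
have cb0 : (centre b0).1 <= (centre c0).1.
  have /imageP[c cD ec] := vD ord0.
  have /existsP[i /eqP ei] := Dw _ cD.
  by move/(congr1 fst): ec; rewrite ei /path_pos /=; lia.
have bc0 : (centre c0).1 <= (centre b0).1.
  have /imageP[c cD ec] := wD ord0.
  have /existsP[i /eqP ei] := Dv _ cD.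
  by move/(congr1 fst): ec; rewrite ei /path_pos /=; lia.
have e0 : (centre b0).1 = (centre c0).1 by apply/eqP; rewrite eq_le cb0.
have col n : (n <= k.*2 + k')%N ->
    (n <= l.*2 + l')%N /\ path_pos (centre b0) w n = path_pos (centre c0) v n.
  move=> le_n; have /imageP[c cD ec] := vD (Ordinal (le_n : (n < _.+1)%N)).
  have /existsP[i /eqP ei] := Dw _ cD.
  have eni : n = i.
    by move/(congr1 fst): ec e0; rewrite ei /path_pos /=; lia.
  by move: ec; rewrite ei /= -eni => ->; rewrite -ltnS {1}eni ltn_ord.
have [le_kl _] := col _ (leqnn _).
have esum : (l.*2 + l' = k.*2 + k')%N by apply/eqP; rewrite eqn_leq le_lk.
have [_ /(congr1 snd) /=] := col 0%N isT; rewrite !start => y0.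
have [_ /(congr1 snd) /=] := col _ (leqnn _); rewrite hv -esum hw => y1.
have ell' : l' = k' by lia.
split=> //; move: esum; rewrite ell' => /eqP; rewrite eqn_add2r => /eqP.
exact: double_inj.
Qed.

Lemma strip_lengthP N l l' (D : {set box N}) :
  is_strip_of l l' D -> is_strip D /\ strip_length D = (l, l').
Proof.
move=> DP; have lt_N : (l.*2 + l' < N)%N.
  case/existsP: DP => b0 /existsP[w /and3P[_ /forallP/(_ ord_max) wD _]].
  case/imageP: wD => c _ /(congr1 fst); rewrite /path_pos /= /column.
  have := ltn_ord c.1.
  by move: (nat_of_ord c.1) (nat_of_ord b0.1) => i j; lia.
have lN : (l < N)%N.
  by apply: leq_ltn_trans lt_N; rewrite -addnn -addnA leq_addr.
have l'N : (l' < N)%N by apply: leq_ltn_trans lt_N; rewrite leq_addl.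
split.
  by apply/existsP; exists (Ordinal lN); apply/existsP; exists (Ordinal l'N).
rewrite /strip_length; case: pickP => [[i j] /= ijP|].
  by have [-> ->] := is_strip_of_uniq ijP DP.
by move/(_ (Ordinal lN, Ordinal l'N)); rewrite /= DP.
Qed.

Definition rightmost (N : nat) (D : {set box N}) (b : box N) : bool :=
  (b \in D) && [forall c in D, column c <= column b]%N.

Definition rule0 (N : nat) (C : {set {set box N}}) : bool :=
  [forall D in C, (0 < (strip_length D).2)%N ==>
     [forall b, rightmost D b ==> is_anchor b]].

Definition is_conf (N : nat) (a b : word N) (C : {set {set box N}}) : bool :=
  [&& partition C (region a b), [forall D in C, is_strip D] & rule0 C].

(* Some box of D is just below a box of D'; equivalently, some box of D' is
   just above a box of D. *)
Definition just_below (N : nat) (D D' : {set box N}) : bool :=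
  [exists b in D', has_pos D (below (centre b))].

(* "All boxes just below" means all such positions, including those outside
   the region, where the condition fails. *)
Definition ruleIa (N : nat) (C : {set {set box N}}) : bool :=
  [forall D in C, forall D' in C, just_below D D' ==>
     [forall b in D', has_pos D (below (centre b))]].

Definition strip_count (N : nat) (C : {set {set box N}}) (l l' : nat) : nat :=
  #|[set D in C | strip_length D == (l, l')]|.

Definition ruleIb (N m : nat) (C : {set {set box N}}) : bool :=
  [forall l : 'I_N, forall l' : 'I_N, (m <= l')%N ==>
     if odd (l' - m) then strip_count C l l' == 0%N
     else ~~ odd (strip_count C l l')].

Definition upper (p : int * int) : seq (int * int) := [:: above p; NW p; NE p].

(* D and D' are distinct strips: otherwise every strip with at least two boxes
   would be excluded.  As in ruleIa, positions outside the region count, except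
   those with first coordinate > N. *)
Definition ruleIIa (N : nat) (C : {set {set box N}}) : bool :=
  [forall D in C, forall D' in C, (D' != D) ==>
     [exists b in D, has (has_pos D') (upper (centre b))] ==>
     [forall b in D, all (fun p : int * int =>
                            (p.1 <= N%:Z) ==> has_pos D p || has_pos D' p)
                         (upper (centre b))]].

Definition ruleIIb (N m : nat) (C : {set {set box N}}) : bool :=
  [forall D in C, let: (l, l') := strip_length D in (m <= l')%N ==>
     if odd (l' - m) then
       [exists E in C, [&& (strip_length E).1 <= l,
                           (strip_length E).2 == l'.-1 & just_below E D]]%N
     else
       [exists E in C, [&& l <= (strip_length E).1,
                           (strip_length E).2 == l'.+1 & just_below D E]]%N].

(* The parameter of CaseB is m. *)
Inductive parameter_case := CaseA | CaseB of nat.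

Inductive rule := RuleI | RuleII.

Definition satisfies_rule (X : parameter_case) (Y : rule) (N : nat)
    (C : {set {set box N}}) : bool :=
  match Y, X with
  | RuleI, CaseA => ruleIa C
  | RuleI, CaseB m => ruleIa C && ruleIb m C
  | RuleII, CaseA => ruleIIa C
  | RuleII, CaseB m => ruleIIa C && ruleIIb m C
  end.

Definition Conf (X : parameter_case) (Y : rule) (N : nat) (a b : word N) :
    {set {set {set box N}}} :=
  [set C | is_conf a b C && satisfies_rule X Y C].

Definition rule_sign (R : comNzRingType) (Y : rule) : R :=
  if Y is RuleI then 1 else -1.

Definition wtA (R : comNzRingType) (t tN sigma : R) (l l' : nat) : R :=
  if odd l' then - sigma * t ^+ (l.*2 + l' - 1) * tN ^+ 2
  else t ^+ (l.*2 + l').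

Definition wtB (R : comNzRingType) (t sigma : R) (m l l' : nat) : R :=
  if (l' < m)%N then sigma ^+ l' * t ^+ (l.*2 + l'.*2)
  else if odd (l' - m) then t ^+ (m + l' + l.*2 - 1)
  else t ^+ (m + l' + l.*2).

Definition wt (R : comNzRingType) (t tN : R) (X : parameter_case) (Y : rule)
    (N : nat) (D : {set box N}) : R :=
  let: (l, l') := strip_length D in
  match X with
  | CaseA => wtA t tN (rule_sign R Y) l l'
  | CaseB m => wtB t (rule_sign R Y) m l l'
  end.

Definition Q (R : comNzRingType) (t tN : R) (X : parameter_case) (Y : rule)
    (N : nat) (a b : word N) : R :=
  if path_le a b
  then \sum_(C in Conf X Y a b) \prod_(D in C) wt t tN X Y D
  else 0.

(* Algebraic independence over Z: p is evaluated at t in its inner variable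
   and at tN in its outer one. *)
Definition alg_independent (R : comNzRingType) (t tN : R) : Prop :=
  forall p : {poly {poly int}},
    (map_poly (fun q : {poly int} => (map_poly intr q).[t]) p).[tN] = 0 ->
    p = 0.

Definition admissible (R : comNzRingType) (t tN : R) (X : parameter_case) :
    Prop :=
  match X with
  | CaseA => alg_independent t tN
  | CaseB m => (0 < m)%N /\ tN = t ^+ m
  end.

(* Main.v *)
(** Idea.  Rule I forces the strips to follow the lower path and to be nested
    towards it, Rule II the same with the upper path; so in both cases a
    configuration is the sequence of the numbers r_x of boxes of column x whose
    strip goes on to column x + 1, and Q is computed by a transfer operator
    scanning the columns from left to right.  Under Rule II the r_x are
    determined: column gamma of the matrix is a product over the arcs of gamma
    (matched pairs 2..1) and its unmatched 2's.  For Rule I a local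
    computation in two adjacent columns gives
      Q(alpha, u 21 v) - Q(alpha, u 12 v)
        = [alpha has 21 at this place] t^(2n) Q(alpha with 21 removed, uv),
    n being the number of boxes in the column of the peak.  This cancels
    against the support of column gamma as soon as gamma contains 21, and the
    identity follows by induction on N.  If gamma = 1^a 2^b, leading 1's are
    inert, and a final 2 (two final 2's once the excess of the anchored strips
    has reached m in Case B) is removed by an analogous computation in the last
    columns, at the price of shifting the excesses in the anchor weights. *)

Require Import Defs.
From mathcomp Require Import all_boot all_order all_algebra.
From mathcomp Require Import zify ring.
Set Implicit Arguments.
Unset Strict Implicit.
Unset Printing Implicit Defensive.
Import Order.TTheory GRing.Theory Num.Theory.
Local Open Scope ring_scope.

(** * Transfer operators *)

(** Start columns are kept because Rule I(b) compares lengths of anchored strips. Only their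
    equality matters, so the two columns of a peak can be deleted up to relabelling. If gamma has 21
    at some place, the paths beta with 21 and with 12 there have opposite signed Rule II sums, so
    the sum over beta sees only the Rule I difference. Final 2's offer no peak, and removing their
    column alters the statement: every strip passing through it has gained one unit of excess. The
    induction is therefore run with all anchor excesses raised by a shift s. In Case A, or for s <
    m, the Rule II weight at excess s is (-1)^s times the Rule I weight, and one column cancels.
    From s = m on, parts (b) bind: Rule I admits excess s only in pairs of equal strips, Rule II
    only as the lower member of a pair s+1, s, and both pairs have the same product of weights. Then
    only two columns together cancel, so s - m stays even. *)

(* The strips meeting a column, starting with the one closest to the base path:
   for each of them the column where it starts and the height of its current
   box above the first one. *)
Definition state := seq (nat * nat).

Definition bump_row (up : bool) (i : nat * nat) : nat * nat :=
  (i.1, if up then i.2.+1 else i.2.-1).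

Definition closed_row (i : nat * nat) : bool := (i.2 == 0)%N.

(** By Rule 0 a strip of positive excess cannot stop before the last column, so the rows that are
    not linked must be closed. On a down step a linked closed row would fall below its starting
    height. *)
Definition row_ok (up : bool) (r : nat) (S : state) : bool :=
  all closed_row (drop r S) && (up || all (predC closed_row) (take r S)).

Definition step (x : nat) (up : bool) (n r : nat) (S : state) : state :=
  map (bump_row up) (take r S) ++ nseq (n - r) (x, 0%N).

(* Here p and q are steps of the base path (the lower one under Rule I, the upper
   one under Rule II) and of the other path. *)
Definition link_counts (Y : rule) (p q : bool) (n : nat) : seq nat :=
  match Y with
  | RuleI => index_iota 0 (n + (p ==> q))
  | RuleII => if p then [:: n] else if (q <= n)%N then [:: n - q]%N else [::]
  end.

Definition next_size (Y : rule) (p q : bool) (n : nat) : nat :=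
  match Y with RuleI => n + q - p | RuleII => n + p - q end.

Section Transfer.
Variables (R : comNzRingType) (t : R).

(** Every down step of a strip costs [t ^+ 2], so a strip of length (l, l') collects t^(2l) here;
    its remaining factor depends on l' alone and is left to the final functional. The powers of [e]
    count the boxes of the region: [e] is 1 for Rule I and -1 for Rule II. *)
Definition transfer (Y : rule) (e : R) (x : nat) (p q : bool)
    (G : state -> R) (S : state) : R :=
  \sum_(r <- link_counts Y p q (size S))
     if row_ok p r S
     then e ^+ next_size Y p q (size S) * (if p then 1 else t ^+ r.*2)
            * G (step x p (next_size Y p q (size S)) r S)
     else 0.

Fixpoint genfun (Y : rule) (e : R) (F : state -> R) (x : nat) (S : state)
    (ps qs : seq bool) : R :=
  match ps, qs with
  | p :: ps', q :: qs' =>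
      transfer Y e x.+1 p q (fun S' => genfun Y e F x.+1 S' ps' qs') S
  | _, _ => F S
  end.

Lemma eq_transfer Y e x p q G H S :
  G =1 H -> transfer Y e x p q G S = transfer Y e x p q H S.
Proof. by move=> eGH; apply: eq_bigr => r _; rewrite eGH. Qed.

Lemma transfer_lin Y e x p q c d G H S :
  transfer Y e x p q (fun U => c * G U + d * H U) S =
  c * transfer Y e x p q G S + d * transfer Y e x p q H S.
Proof.
rewrite /transfer !mulr_sumr -big_split /=; apply: eq_bigr => r _.
by case: ifP => _; [ring | rewrite !mulr0 addr0].
Qed.

Lemma transferZ Y e x p q c G S :
  transfer Y e x p q (fun U => c * G U) S = c * transfer Y e x p q G S.
Proof.
rewrite /transfer mulr_sumr; apply: eq_bigr => r _.
by case: ifP => _; [ring | rewrite mulr0].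
Qed.

(** * Local identities for Rule I *)

Lemma transferI x p q G S :
  transfer RuleI 1 x p q G S =
  \sum_(0 <= r < size S + (p ==> q))
     if row_ok p r S
     then (if p then 1 else t ^+ r.*2) * G (step x p (size S + q - p) r S)
     else 0.
Proof. by apply: eq_bigr => r _; rewrite expr1n mul1r. Qed.

Lemma step_rcons_state x p n r S z :
  (r <= size S)%N -> step x p n r (rcons S z) = step x p n r S.
Proof. by move=> le_r; rewrite /step -cats1 takel_cat. Qed.

Lemma step_succ x p n r S :
  (r <= n)%N -> step x p n.+1 r S = rcons (step x p n r S) (x, 0%N).
Proof.
move=> le_r; rewrite /step subSn // -cats1 -catA; congr (_ ++ _).
by rewrite -addn1 nseqD.
Qed.

Lemma size_step x p n r S :
  (r <= size S)%N -> (r <= n)%N -> size (step x p n r S) = n.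
Proof.
by move=> le_r le_n; rewrite size_cat size_map size_nseq size_takel // subnKC.
Qed.

Lemma row_ok_rcons p r S y :
  (r <= size S)%N -> row_ok p r (rcons S (y, 0%N)) = row_ok p r S.
Proof.
move=> le_r; rewrite /row_ok -cats1 takel_cat // drop_cat.
move: le_r; rewrite leq_eqVlt => /predU1P[->|->].
  by rewrite ltnn subnn drop0 drop_size.
by rewrite all_cat /= andbT.
Qed.

Lemma row_ok_rcons_full S y : row_ok false (size S).+1 (rcons S (y, 0%N)) = false.
Proof.
by rewrite /row_ok take_oversize ?size_rcons // all_rcons /= andbF.
Qed.

(** The closed last row cannot be linked: its height forbids it on a down step, the range of r on an
    up step. It then only makes room for one more row in the next column, which is the effect of an
    up step of the upper path. *)
Lemma transferI_closed_row x p G U y :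
  transfer RuleI 1 x p false G (rcons U (y, 0%N)) =
  transfer RuleI 1 x p true G U.
Proof.
rewrite !transferI size_rcons implybT; case: p => /=.
  rewrite addn0 addn1; apply: eq_big_nat => r /= le_r.
  by rewrite row_ok_rcons // step_rcons_state // addn0 addnK subn1.
rewrite addn1 big_nat_recr //= row_ok_rcons_full addr0 addn1.
apply: eq_big_nat => r /= le_r.
by rewrite row_ok_rcons // step_rcons_state // addn0.
Qed.

Lemma transferI_down x G S :
  transfer RuleI 1 x false true G S =
  transfer RuleI 1 x false false (fun U => G (rcons U (x, 0%N))) S.
Proof.
rewrite !transferI /= addn1 !subn0 addn0; apply: eq_big_nat => r /= le_r.
by rewrite step_succ.
Qed.

Lemma row_ok_all_up S : row_ok true (size S) S.
Proof. by rewrite /row_ok drop_size. Qed.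

(** Linking fewer than all rows leaves a new row at the end, as after a down step of the upper path;
    linking all of them opens none, which is the extra term. *)
Lemma transferI_up x G S :
  transfer RuleI 1 x true true G S =
  transfer RuleI 1 x true false (fun U => G (rcons U (x, 0%N))) S
    + G (map (bump_row true) S).
Proof.
rewrite !transferI /= addn1 addn0 !subn1 /= big_nat_recr //= row_ok_all_up mul1r.
have -> : step x true (size S) (size S) S = map (bump_row true) S.
  by rewrite /step take_size subnn cats0.
congr (_ + _).
apply: eq_big_nat => r /= lt_r.
have [n eS]: exists n, size S = n.+1 by exists (size S).-1; rewrite prednK //; lia.
by rewrite eS /= step_succ // -ltnS -eS.
Qed.

Lemma all_closed_bump r S :
  (r < size S)%N -> all closed_row (drop r (map (bump_row true) S)) = false.
Proof.
by move=> lt_r; rewrite -map_drop (drop_nth (0, 0)%N) //.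
Qed.

(** After a common bump no row is closed, so every row has to be linked, and a down step of the
    upper path would leave too little room. *)
Lemma transferI_bumped_up x q G S :
  transfer RuleI 1 x true q G (map (bump_row true) S) =
  if q then G (map (bump_row true) (map (bump_row true) S)) else 0.
Proof.
case: q; last first.
  rewrite transferI /= size_map big_nat big1 // => r /=; rewrite addn0 => lt_r.
  by rewrite /row_ok all_closed_bump.
rewrite transferI_up transferI /= size_map big_nat big1 ?add0r // => r /=.
by rewrite addn0 => lt_r; rewrite /row_ok all_closed_bump.
Qed.

Lemma bump_rowK S : map (bump_row false) (map (bump_row true) S) = S.
Proof. by rewrite -map_comp -[RHS]map_id; apply: eq_map => -[]. Qed.

Lemma transferI_bumped_down x q G S :
  transfer RuleI 1 x false q G (map (bump_row true) S) =
  t ^+ (size S).*2 * G (S ++ nseq q (x, 0%N)).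
Proof.
rewrite transferI /= addn1 big_nat_recr //= big_nat big1 => [|r /= lt_r].
  rewrite add0r /row_ok drop_size take_size /step /= take_size bump_rowK.
  rewrite size_map subn0 [X in nseq X]addKn.
  suff -> : all (predC closed_row) (map (bump_row true) S) by [].
  by rewrite all_map; apply/allP.
by rewrite /row_ok all_closed_bump //; rewrite size_map in lt_r.
Qed.

(** If a row is opened at the up step of the upper path, it is closed at the next step and can be
    exchanged for the order down-up. What remains is the term where all rows are linked upwards;
    they must all come down again, at cost t^(2n), and the state is restored. *)
Lemma transferI_peak x y a1 a2 G S :
  transfer RuleI 1 x a1 true (transfer RuleI 1 y a2 false G) S =
  transfer RuleI 1 x a1 false (transfer RuleI 1 y a2 true G) S
   + (if a1 && ~~ a2 then t ^+ (size S).*2 * G S else 0).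
Proof.
case: a1 => /=.
  rewrite transferI_up; congr (_ + _).
    by apply: eq_transfer => U; rewrite transferI_closed_row.
  by case: a2; rewrite ?transferI_bumped_up // transferI_bumped_down cats0.
rewrite transferI_down // addr0.
by apply: eq_transfer => U; rewrite transferI_closed_row.
Qed.

(** * Independence of the labels, support, and passage along a prefix *)

Definition relabel (f : nat -> nat) (S : state) : state :=
  [seq (f i.1, i.2) | i <- S].

Lemma relabel_step f x y p n r S :
  f x = y -> relabel f (step x p n r S) = step y p n r (relabel f S).
Proof.
move=> <-; rewrite /relabel /step map_cat map_nseq -map_take -!map_comp.
by congr (_ ++ _).
Qed.

Lemma row_ok_relabel f p r S : row_ok p r (relabel f S) = row_ok p r S.
Proof. by rewrite /row_ok /relabel -map_drop -map_take !all_map. Qed.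

(** Transfers carry labels along without testing them; only the final functional reads them. *)
Lemma genfun_relabel Y e F f x y S ps qs :
  (forall U, F (relabel f U) = F U) ->
  (forall k, f (x + k.+1)%N = (y + k.+1)%N) ->
  genfun Y e F y (relabel f S) ps qs = genfun Y e F x S ps qs.
Proof.
move=> FfE; elim: ps qs x y S => [|p ps IH] [|q qs] x y S fE //=.
rewrite /transfer size_map; apply: eq_bigr => r _; rewrite row_ok_relabel.
case: ifP => // _; congr (_ * _).
rewrite -(relabel_step _ _ _ _ (_ : f x.+1 = y.+1)); last first.
  by rewrite -addn1 fE addn1.
by apply: IH => k; have := fE k.+1; rewrite !addnS !addSn.
Qed.

Definition labels_le (x : nat) (S : state) : bool := all (fun i => i.1 <= x)%N S.

Definition size_rel (Y : rule) (p q : bool) (n n' : nat) : Prop :=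
  match Y with RuleI => n' + p = n + q | RuleII => n' + q = n + p end%N.

Lemma link_countsP Y p q n r :
  r \in link_counts Y p q n ->
  [/\ (r <= n)%N, (r <= next_size Y p q n)%N
    & size_rel Y p q n (next_size Y p q n)].
Proof.
case: Y => /=.
  by rewrite mem_index_iota; case: p; case: q => /= lt_r; split; lia.
case: p; first by rewrite inE => /eqP->; case: q; split; lia.
by case: ifP => // le_q; rewrite inE => /eqP->; split; lia.
Qed.

Lemma labels_step x p n r S : labels_le x S -> labels_le x.+1 (step x.+1 p n r S).
Proof.
move=> /allP lS; rewrite /labels_le /step all_cat all_map all_nseq /= leqnn orbT.
by rewrite andbT; apply/allP => i /mem_take/lS /=; lia.
Qed.

Lemma eq_transfer_in Y e x p q G H S :
  labels_le x S ->
  (forall U, size_rel Y p q (size S) (size U) -> labels_le x.+1 U -> G U = H U) ->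
  transfer Y e x.+1 p q G S = transfer Y e x.+1 p q H S.
Proof.
move=> lS eGH; rewrite /transfer !big_seq; apply: eq_bigr => r /link_countsP.
case=> le_r le_n rel_n; case: ifP => // _; rewrite eGH ?labels_step //.
by rewrite size_step.
Qed.

Lemma transfer_eq0 Y e x p q G S :
  labels_le x S ->
  (forall U, size_rel Y p q (size S) (size U) -> labels_le x.+1 U -> G U = 0) ->
  transfer Y e x.+1 p q G S = 0.
Proof.
move=> lS G0; rewrite (@eq_transfer_in _ _ _ _ _ _ (fun=> 0)) //.
by rewrite /transfer big1 // => r _; rewrite mulr0 if_same.
Qed.

Notation ups := (count id).

(** The number of rows changes by the difference of the two steps and cannot become negative. This
    support condition later justifies truncated subtraction in the exponents of [t]. *)
Lemma genfunI_lt F x S al al2 be be2 :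
  labels_le x S -> size al = size be -> (size S + ups be < ups al)%N ->
  genfun RuleI 1 F x S (al ++ al2) (be ++ be2) = 0.
Proof.
elim: al be x S => [|a al IH] [|b be] x S //= lS [es] lt_ups.
apply: transfer_eq0 => // U /= eU lU; apply: IH => //.
by move: eU lt_ups; case: a; case: b => /=; lia.
Qed.

Lemma genfunII_lt F e x S ga ga2 be be2 :
  labels_le x S -> size ga = size be -> (size S + ups ga < ups be)%N ->
  genfun RuleII e F x S (ga ++ ga2) (be ++ be2) = 0.
Proof.
elim: ga be x S => [|a al IH] [|b be] x S //= lS [es] lt_ups.
apply: transfer_eq0 => // U /= eU lU; apply: IH => //.
by move: eU lt_ups; case: a; case: b => /=; lia.
Qed.

Definition relabel_inv (F : state -> R) : Prop :=
  forall f U, injective f -> F (relabel f U) = F U.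

(* The labels already in use are at most x, so the columns x+1 and x+2 can be
   removed from the count. *)
Lemma genfun_skip2 Y e F x S ps qs :
  relabel_inv F -> labels_le x S ->
  genfun Y e F x.+2 S ps qs = genfun Y e F x S ps qs.
Proof.
move=> Finv lS; pose f s := if (s <= x)%N then s else s.+2.
have f_inj : injective f by move=> i j; rewrite /f; do 2 case: ifP; lia.
have fS : relabel f S = S.
  rewrite /relabel -[RHS]map_id; apply/eq_in_map => -[s v] /(allP lS) /= le_s.
  by rewrite /f le_s.
rewrite -{1}fS; apply: genfun_relabel => [U|k]; first exact: Finv.
by rewrite /f ifF; lia.
Qed.

Lemma genfunI_peak F x S al1 a1 a2 al2 be1 be2 :
  relabel_inv F -> labels_le x S -> size al1 = size be1 ->
  genfun RuleI 1 F x S (al1 ++ a1 :: a2 :: al2) (be1 ++ true :: false :: be2) =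
  genfun RuleI 1 F x S (al1 ++ a1 :: a2 :: al2) (be1 ++ false :: true :: be2)
  + (a1 && ~~ a2)%:R * t ^+ (size S + ups be1 - ups al1).*2
      * genfun RuleI 1 F x S (al1 ++ al2) (be1 ++ be2).
Proof.
move=> Finv; elim: al1 be1 x S => [|a al1 IH] [|b be1] x S //= lS.
  move=> _; rewrite addn0 subn0 transferI_peak; congr (_ + _).
  by case: ifP => _; rewrite ?mul1r ?mul0r // genfun_skip2.
case=> es; rewrite -[X in X + _]mul1r -transfer_lin.
apply: eq_transfer_in => // U /= eU lU.
rewrite IH // mul1r; congr (_ + _ * _ ^+ _.*2 * _).
by move: eU; case: a; case: b => /=; lia.
Qed.

(** A final up step of the upper path adds to each term of a final down step one row that starts in
    the last column, which [F] trades for [c]. The additional term links all rows upwards and opens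
    none. *)
Lemma genfunI_last F F' c x S al a be :
  (forall U y, F (rcons U (y, 0%N)) = c * F U) ->
  (forall U, F (map (bump_row true) U) = F' U) ->
  labels_le x S -> size al = size be ->
  genfun RuleI 1 F x S (rcons al a) (rcons be true) =
  c * genfun RuleI 1 F x S (rcons al a) (rcons be false)
  + a%:R * genfun RuleI 1 F' x S al be.
Proof.
move=> Fr Fb; elim: al be x S => [|a' al IH] [|b be] x S //= lS.
  move=> _; rewrite -!transferZ; case: a; rewrite ?mul1r ?mul0r ?addr0.
    by rewrite transferI_up Fb; congr (_ + _); apply: eq_transfer => U.
  by rewrite transferI_down; apply: eq_transfer => U.
case=> es; rewrite -transfer_lin; apply: eq_transfer_in => // U _ lU.
exact: IH.
Qed.

(** The hypotheses abstract Rule I(b) at an excess of even parity: equal new rows count in pairs, a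
    new row without partner is fatal, and so is the odd excess one higher. They kill the terms
    linking all of [U] or more on an up step; every other term gains two new rows. *)
Lemma transferI_closed_pair F c x p U y :
  (forall V z, F (rcons (rcons V (z, 0%N)) (z, 0%N)) = c * F V) ->
  (forall V z, (z, 0%N) \notin V -> F (rcons V (z, 0%N)) = 0) ->
  (forall V i, i \in V -> i.2 = 1%N -> F V = 0) ->
  transfer RuleI 1 x p true F (rcons U (y, 0%N)) =
  c * transfer RuleI 1 x p false F U.
Proof.
move=> F2 F1 F0; rewrite -transferZ !transferI size_rcons; case: p => /=.
  rewrite addn1 addn0 !subn1 /= !big_nat_recr //= -addrA.
  rewrite [X in _ + X](_ : _ = 0) ?addr0.
    apply: eq_big_nat => r /= lt_r.
    rewrite row_ok_rcons 1?ltnW // step_rcons_state 1?ltnW //.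
    case: ifP => // _; congr (_ * _).
    have [n eU] : exists n, size U = n.+1 by exists (size U).-1; lia.
    by rewrite eU /= !step_succ ?F2 //; lia.
  rewrite step_rcons_state // step_succ // F1; last first.
    rewrite /step take_size subnn cats0; apply/negP => /mapP[i _].
    by case.
  rewrite [F _](F0 _ (y, 1%N)) ?mulr0 ?if_same ?addr0 //.
  rewrite /step take_oversize ?size_rcons // mem_cat; apply/orP; left.
  by apply/mapP; exists (y, 0%N); rewrite // mem_rcons inE eqxx.
rewrite addn1 !subn0 big_nat_recr //= row_ok_rcons_full addr0 !addn1 addn0.
apply: eq_big_nat => r /= lt_r; rewrite row_ok_rcons // step_rcons_state //.
case: ifP => // _; rewrite !step_succ ?F2 //; exact: leqW.
Qed.

Lemma genfunI_last2 F F' c x S al a1 a2 be :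
  (forall V z, F (rcons (rcons V (z, 0%N)) (z, 0%N)) = c * F V) ->
  (forall V z, (z, 0%N) \notin V -> F (rcons V (z, 0%N)) = 0) ->
  (forall V i, i \in V -> i.2 = 1%N -> F V = 0) ->
  (forall U, F (map (bump_row true) (map (bump_row true) U)) = F' U) ->
  labels_le x S -> size al = size be ->
  genfun RuleI 1 F x S (al ++ [:: a1; a2]) (be ++ [:: true; true]) =
  c * genfun RuleI 1 F x S (al ++ [:: a1; a2]) (be ++ [:: false; false])
  + (a1 && a2)%:R * genfun RuleI 1 F' x S al be.
Proof.
move=> F2 F1 F0 Fb; elim: al be x S => [|a' al IH] [|b be] x S //= lS.
  move=> _; rewrite -transferZ; case: a1 => /=; last first.
    rewrite transferI_down mul0r addr0; apply: eq_transfer => U.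
    exact: transferI_closed_pair.
  rewrite transferI_up; congr (_ + _).
    by apply: eq_transfer => U; exact: transferI_closed_pair.
  case: a2; first by rewrite transferI_bumped_up Fb mul1r.
  (* The new row is labelled by a column beyond all labels of [S], so it has no partner. *)
  rewrite transferI_bumped_down mul0r cats1 F1 ?mulr0 //.
  by apply/negP => /(allP lS) /=; lia.
case=> es; rewrite -transfer_lin; apply: eq_transfer_in => // U _ lU.
exact: IH.
Qed.

(** * Local identities for Rule II *)

Lemma transferII e x p q G S :
  transfer RuleII e x p q G S =
  if p then e ^+ (size S + ~~ q) * G (step x true (size S + ~~ q) (size S) S)
  else if (q <= size S)%N && row_ok false (size S - q) S
  then e ^+ (size S - q) * t ^+ (size S - q).*2
         * G (step x false (size S - q) (size S - q) S)
  else 0.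
Proof.
rewrite /transfer /=; case: p.
  rewrite big_seq1 row_ok_all_up mulr1.
  by have -> : (size S + true - q = size S + ~~ q)%N by case: q; lia.
by case: ifP => //= _; rewrite ?big_seq1 ?big_nil ?addn0.
Qed.

Lemma step_up_all x n S :
  step x true n (size S) S = map (bump_row true) S ++ nseq (n - size S) (x, 0%N).
Proof. by rewrite /step take_size. Qed.

(** On the up step all old rows rise and on the down step they must all be linked back. The link
    count allows this only if a row opened by [b1] is dropped by [b2], or none is opened and none
    dropped; the opened row is one extra box, whence the sign. *)
Lemma transferII_peak x y b1 b2 G S :
  transfer RuleII (-1) x true b1 (transfer RuleII (-1) y false b2 G) S =
  if b1 (+) b2 then (-1) ^+ (~~ b1) * t ^+ (size S).*2 * G S else 0.
Proof.
rewrite transferII step_up_all addKn transferII size_cat size_map size_nseq.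
set U := map _ S; have posU : all (predC closed_row) U.
  by rewrite all_map; apply/allP.
have szU : size U = size S by rewrite size_map.
case: b1; rewrite /= ?addn0 ?cats0.
  case: b2 => /=; last first.
    rewrite subn0 /row_ok -szU drop_size take_size posU /= mulrA mulrA -exprD.
    rewrite addnn -mul2n exprM sqrrN expr1n expr1n !mul1r; congr (_ * G _).
    by rewrite /step take_size subnn cats0 bump_rowK.
  have [S0|S_gt0] := posnP (size S); first by rewrite S0 mulr0.
  by rewrite /row_ok all_closed_bump ?andbF ?mulr0 //; lia.
rewrite addn1; case: b2 => /=.
  rewrite subn1 /= /row_ok -szU drop_size_cat // take_size_cat // posU /=.
  rewrite mulrA mulrA -exprD addSn addnn exprS -mul2n exprM sqrrN !expr1n mulr1.
  congr (_ * G _).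
  by rewrite /step take_size_cat // subnn cats0 bump_rowK.
rewrite /row_ok subn0 take_oversize; last by rewrite size_cat szU addn1.
by rewrite all_cat /= !andbF mulr0.
Qed.

Lemma genfunII_peak F x S ga1 ga2 be1 b1 b2 be2 :
  relabel_inv F -> labels_le x S -> size ga1 = size be1 ->
  genfun RuleII (-1) F x S (ga1 ++ true :: false :: ga2)
                           (be1 ++ b1 :: b2 :: be2) =
  if b1 (+) b2
  then (-1) ^+ (~~ b1) * t ^+ (size S + ups ga1 - ups be1).*2
         * genfun RuleII (-1) F x S (ga1 ++ ga2) (be1 ++ be2)
  else 0.
Proof.
move=> Finv; elim: ga1 be1 x S => [|g ga1 IH] [|b be1] x S //= lS.
  by rewrite addn0 subn0 transferII_peak genfun_skip2.
case=> es; case: ifP => bb; last first.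
  by apply: transfer_eq0 => // U _ lU; rewrite IH ?bb.
rewrite -transferZ; apply: eq_transfer_in => // U /= eU lU.
rewrite IH ?bb //; congr (_ * _ ^+ _.*2 * _).
by move: eU; case: g; case: b => /=; lia.
Qed.

Lemma genfunII_last F F' c x S ga be b :
  (forall U, (-1) ^+ size U * F (map (bump_row true) U) = F' U) ->
  (forall U y, (-1) ^+ (size U).+1 * F (rcons (map (bump_row true) U) (y, 0%N))
               = - c * F' U) ->
  labels_le x S -> size ga = size be ->
  genfun RuleII (-1) F x S (rcons ga true) (rcons be b) =
  (if b then 1 else - c) * genfun RuleII (-1) F' x S ga be.
Proof.
move=> Fb Fr; elim: ga be x S => [|g ga IH] [|b' be] x S //= lS.
  move=> _; rewrite transferII step_up_all addKn.
  case: b => /=; first by rewrite addn0 cats0 Fb mul1r.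
  by rewrite cats1 addn1 Fr.
case=> es; rewrite -transferZ; apply: eq_transfer_in => // U _ lU.
exact: IH.
Qed.

(** Two down steps of the lower path leave rows of excess 1 and 0 below rows of excess at least 2;
    exactly one down step leaves a lone row of excess 0 or 1, which [F1] excludes. In the former
    case the two columns have consecutive sizes, hence [- c]. *)
Lemma genfunII_last2 F F' c x S ga be b1 b2 :
  (forall U, F (map (bump_row true) (map (bump_row true) U)) = F' U) ->
  (forall U y z, F (rcons (rcons (map (bump_row true) (map (bump_row true) U))
                            (y, 1%N)) (z, 0%N)) = c * F' U) ->
  (forall U y v, (v <= 1)%N ->
     F (rcons (map (bump_row true) (map (bump_row true) U)) (y, v)) = 0) ->
  labels_le x S -> size ga = size be ->
  genfun RuleII (-1) F x S (ga ++ [:: true; true]) (be ++ [:: b1; b2]) =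
  (if b1 == b2 then if b1 then 1 else - c else 0)
    * genfun RuleII (-1) F' x S ga be.
Proof.
move=> Fb F2 F1; elim: ga be x S => [|g ga IH] [|b' be] x S //= lS.
  move=> _; rewrite !transferII !step_up_all !addKn size_cat size_map.
  rewrite size_nseq map_cat.
  case: b1; case: b2; rewrite /= ?cats0 ?addn0 ?addn1 ?addn0.
  - by rewrite Fb mulrA -exprD addnn -mul2n exprM sqrrN !expr1n.
  - by rewrite cats1 F1 // !mulr0 mul0r.
  - by rewrite cats1 F1 // !mulr0 mul0r.
  - rewrite !cats1 F2 !exprS; have := sqrr_sign R (size S).
    by move: (_ ^+ size S) => e e2; ring: e2.
case=> es; rewrite -transferZ; apply: eq_transfer_in => // U _ lU.
exact: IH.
Qed.

(** * Weights and parts (b) of the rules in the last column *)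

Variables (tN : R) (X : parameter_case).

(** In both cases the weight of a strip of length (l, l') is t^(2l) times its value at l = 0. *)
Definition anchor_wt (Y : rule) (k : nat) : R :=
  match X with
  | CaseA => wtA t tN (rule_sign R Y) 0 k
  | CaseB m => wtB t (rule_sign R Y) m 0 k
  end.

(* Anchored strips have equal lengths iff they have the same first column and the
   same height l', so this is Rule I(b). *)
Definition even_ok (S : state) : bool :=
  if X is CaseB m
  then all (fun i => (m <= i.2)%N ==>
                     ~~ odd (i.2 - m) && ~~ odd (count_mem i S)) S
  else true.

(** Rule II(b) for row [j], read off the excesses in the last column listed downwards from the upper
    path. The comparison of l and l'' is omitted because nesting of the strips implies it. *)
Definition link_ok (m : nat) (es : seq nat) (j : nat) : bool :=
  (m <= nth 0%N es j)%N ==>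
    if odd (nth 0%N es j - m)
    then (j.+1 < size es)%N && (nth 0%N es j.+1 == (nth 0%N es j).-1)%N
    else (0 < j)%N && (nth 0%N es j.-1 == (nth 0%N es j).+1)%N.

Definition chain_ok (es : seq nat) : bool :=
  if X is CaseB m then all (link_ok m es) (iota 0 (size es)) else true.

Definition closing (Y : rule) (S : state) : R :=
  (if Y is RuleI then even_ok S else chain_ok (map snd S))%:R
    * \prod_(i <- S) anchor_wt Y i.2.

(* The anchor weights left after the removal of s columns with a final 2. *)
Definition shift (s : nat) (S : state) : state :=
  [seq (i.1, (i.2 + s)%N) | i <- S].

Definition closingI (s : nat) (S : state) : R := closing RuleI (shift s S).
(** The sign stands for the boxes of the s removed columns, one for each strip of [S] in each
    column. *)
Definition closingII (s : nat) (S : state) : R :=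
  (-1) ^+ (s * size S) * closing RuleII (shift s S).

(** At these shifts a strip starting in the last column is not yet subject to part (b) of either
    rule. *)
Definition free_shift (s : nat) : bool :=
  if X is CaseB m then (s < m)%N else true.

Lemma shift_bump s S : shift s (map (bump_row true) S) = shift s.+1 S.
Proof. by rewrite /shift -map_comp; apply: eq_map => i /=; rewrite addSnnS. Qed.

Lemma shift_rcons s S i : shift s (rcons S i) = rcons (shift s S) (i.1, (i.2 + s)%N).
Proof. by rewrite /shift map_rcons. Qed.

Lemma shift_relabel s f S : shift s (relabel f S) = relabel f (shift s S).
Proof. by rewrite /shift /relabel -!map_comp. Qed.

Lemma closingI_inv s : relabel_inv (closingI s).
Proof.
move=> f U f_inj; rewrite /closingI shift_relabel.
move: {U}(shift s U) => U; rewrite /closing big_map; congr ((nat_of_bool _)%:R * _).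
rewrite /even_ok; case: X => // m; rewrite all_map.
apply: eq_all => -[x v] /=; rewrite count_map.
rewrite (@eq_count _ _ (pred1 (x, v))) // => -[x' v'] /=.
by rewrite !xpair_eqE (inj_eq f_inj).
Qed.

Lemma closingII_inv s : relabel_inv (closingII s).
Proof.
move=> f U _; rewrite /closingII shift_relabel size_map /closing big_map.
by rewrite /relabel -map_comp.
Qed.

Lemma closingI_rcons s U y :
  free_shift s -> closingI s (rcons U (y, 0%N)) = anchor_wt RuleI s * closingI s U.
Proof.
move=> fs; rewrite /closingI shift_rcons /closing -cats1 big_cat big_seq1 /=.
rewrite add0n [RHS]mulrC -[RHS]mulrA; congr ((nat_of_bool _)%:R * _).
rewrite /even_ok; move: fs; rewrite /free_shift; case: X => // m lt_sm.
rewrite all_cat /= [(m <= s)%N]leqNgt lt_sm /= andbT; apply: eq_all => -[x v] /=.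
rewrite count_cat /=; case: leqP => //= le_mv.
by rewrite xpair_eqE (_ : (s == v) = false) ?andbF ?addn0 //; lia.
Qed.

Lemma closingI_bump s U : closingI s (map (bump_row true) U) = closingI s.+1 U.
Proof. by rewrite /closingI shift_bump. Qed.

Lemma closingII_bump s U :
  (-1) ^+ size U * closingII s (map (bump_row true) U) = closingII s.+1 U.
Proof.
by rewrite /closingII shift_bump mulrA -exprD size_map mulSn.
Qed.

(** This is what the choice of signs in the weights achieves, and it makes the one-column terms of
    the two rules cancel. *)
Lemma anchor_wt_sign s :
  free_shift s -> anchor_wt RuleII s = (-1) ^+ s * anchor_wt RuleI s.
Proof.
rewrite /free_shift /anchor_wt /=.
case: X => [_|m lt_sm]; last by rewrite /wtB lt_sm expr1n mul1r.
by rewrite -signr_odd /wtA; case: odd => /=; ring.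
Qed.

Lemma nth_rcons_last (T : Type) (x0 : T) s z : nth x0 (rcons s z) (size s) = z.
Proof. by rewrite nth_rcons ltnn eqxx. Qed.

(** A row of odd parity is the only kind that looks at its successor, so an appended row matters
    only to a last row of this kind that it satisfies. *)
Lemma link_ok_rcons m (es : seq nat) e j :
  (j < size es)%N ->
  (j.+1 = size es -> (m <= nth 0%N es j)%N -> odd (nth 0%N es j - m) ->
     (nth 0%N es j).-1 != e) ->
  link_ok m (rcons es e) j = link_ok m es j.
Proof.
move=> lt_j He; rewrite /link_ok nth_rcons lt_j; case: (leqP m) => //= le_m.
have jp : (j.-1 < size es)%N by lia.
case: ifP => od; rewrite !nth_rcons; last by rewrite jp.
rewrite size_rcons ltnS lt_j; case: ltnP => //= le_j.
have ej : j.+1 = size es by lia.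
by rewrite ej eqxx eq_sym; apply/negbTE/He.
Qed.

Lemma prod_rcons (T : Type) (S : seq T) i (f : T -> R) :
  \prod_(j <- rcons S i) f j = (\prod_(j <- S) f j) * f i.
Proof. by rewrite -cats1 big_cat big_seq1. Qed.

Lemma closingII_rcons s U y :
  free_shift s ->
  (-1) ^+ (size U).+1 * closingII s (rcons (map (bump_row true) U) (y, 0%N))
  = - anchor_wt RuleI s * closingII s.+1 U.
Proof.
move=> fs; rewrite /closingII shift_rcons shift_bump /closing.
rewrite size_rcons size_map map_rcons prod_rcons /= add0n.
rewrite (anchor_wt_sign fs).
have -> : chain_ok (rcons [seq i.2 | i <- shift s.+1 U] s) =
          chain_ok [seq i.2 | i <- shift s.+1 U].
  rewrite /chain_ok; move: fs; rewrite /free_shift; case: X => // m lt_sm.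
  set es : seq nat := [seq i.2 | i <- _].
  rewrite size_rcons -addn1 iotaD all_cat /= andbT.
  rewrite {2}/link_ok nth_rcons_last [(m <= s)%N]leqNgt lt_sm andbT.
  apply: eq_in_all => j; rewrite mem_iota /= add0n => lt_j.
  (* An odd [v - m] makes [v] exceed [m], so the successor it needs is at least [m], hence larger
     than [s]. *)
  apply: link_ok_rcons => // _; set v := nth _ _ _ => le_mv od.
  have : v != m by apply: contraTneq od => ->; rewrite subnn.
  by lia.
rewrite mulnS mulSn !exprD exprS; have := sqrr_sign R s.
by move: (_ ^+ s) => e e2; ring: e2.
Qed.

(** * Saturated shifts, where anchored strips come in pairs *)

Section Saturated.
Variables (m s : nat).
Hypotheses (XB : X = CaseB m) (le_ms : (m <= s)%N) (even_s : ~~ odd (s - m)).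

Lemma closingI_rcons2 V z :
  closingI s (rcons (rcons V (z, 0%N)) (z, 0%N)) =
  anchor_wt RuleI s ^+ 2 * closingI s V.
Proof.
rewrite /closingI !shift_rcons /closing !prod_rcons /= add0n.
set W := shift s V.
have -> : even_ok (rcons (rcons W (z, s)) (z, s)) = even_ok W; last by ring.
rewrite /even_ok XB -!cats1 -catA all_cat /= le_ms even_s !count_cat /= eqxx.
rewrite !andbT andbb oddD addbF.
have -> : all (fun i => (m <= i.2)%N ==> ~~ odd (i.2 - m)
                && ~~ odd (count_mem i (W ++ [:: (z, s); (z, s)]))) W
        = all (fun i => (m <= i.2)%N ==> ~~ odd (i.2 - m)
                && ~~ odd (count_mem i W)) W.
  by apply: eq_all => i; rewrite !count_cat oddD /=; case: eqP => //=; rewrite addbF.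
apply: andb_idr => /allP W_ok; have [/W_ok|] := boolP ((z, s) \in W).
  by rewrite /= le_ms even_s.
by move/count_memPn->.
Qed.

Lemma closingI_rcons1 V z :
  (z, 0%N) \notin V -> closingI s (rcons V (z, 0%N)) = 0.
Proof.
move=> zV; rewrite /closingI shift_rcons /closing /even_ok XB all_rcons /=.
rewrite add0n le_ms even_s -cats1 count_cat /= eqxx.
rewrite (count_memPn _) ?mul0r //.
apply: contra zV => /mapP[[x v] xv /= [-> e]].
by have -> : 0%N = v by lia.
Qed.

Lemma closingI_odd V i : i \in V -> i.2 = 1%N -> closingI s V = 0.
Proof.
move=> iV i1; rewrite /closingI /closing /even_ok XB.
rewrite (_ : all _ _ = false) ?mul0r //; apply/negbTE/allPn.
exists (i.1, (i.2 + s)%N); first by apply/mapP; exists i.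
by rewrite /= i1 add1n leqW // subSn //= even_s.
Qed.

Lemma closingII_bump2 U :
  closingII s (map (bump_row true) (map (bump_row true) U)) = closingII s.+2 U.
Proof.
rewrite /closingII !shift_bump !size_map !mulSn !exprD mulrA -expr2.
by rewrite sqrr_sign mul1r.
Qed.

(** All other rows have shifted excess at least s+2. A last row of excess s therefore lacks s+1
    above it, and a last row of excess s+1 lacks s below it. *)
Lemma closingII_rcons1 U y v :
  (v <= 1)%N ->
  closingII s (rcons (map (bump_row true) (map (bump_row true) U)) (y, v)) = 0.
Proof.
move=> le_v; rewrite /closingII /closing shift_rcons !shift_bump map_rcons /=.
rewrite /chain_ok XB; set es : seq nat := [seq i.2 | i <- _].
have es_ge (w : nat) : w \in es -> (s.+2 <= w)%N.
  by case/mapP=> -[x e] /mapP[i _ [_ ->]] -> /=; lia.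
rewrite (_ : all _ _ = false) ?mul0r ?mulr0 //; apply/negbTE/allPn.
exists (size es); first by rewrite mem_iota size_rcons /=.
rewrite /link_ok nth_rcons_last size_rcons ltnn /=.
have -> : (m <= v + s)%N by lia.
case: v le_v => [|[]] // _; rewrite ?add0n ?add1n.
  rewrite (negbTE even_s) nth_rcons; case: (posnP (size es)) => //= n0.
  rewrite ifT; last by lia.
  have /es_ge : nth 0%N es (size es).-1 \in es by rewrite mem_nth // ltn_predL.
  by lia.
by rewrite subSn //= even_s.
Qed.

Lemma closingII_rcons2 U y z :
  closingII s (rcons (rcons (map (bump_row true) (map (bump_row true) U))
                       (y, 1%N)) (z, 0%N))
  = anchor_wt RuleI s ^+ 2 * closingII s.+2 U.
Proof.
rewrite /closingII /closing !shift_rcons !shift_bump !map_rcons /= add0n add1n.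
rewrite !prod_rcons !size_rcons !size_map /=.
(* The exponent at odd parity is lowered by one, so both s+1 and s contribute t^(m+s). *)
have -> : anchor_wt RuleI s ^+ 2 = anchor_wt RuleII s.+1 * anchor_wt RuleII s.
  rewrite /anchor_wt XB /wtB !ltnNge le_ms leqW // subSn //= even_s.
  by rewrite (negbTE even_s) -exprM -exprD; congr (_ ^+ _); lia.
have -> : chain_ok (rcons (rcons [seq i.2 | i <- shift s.+2 U] s.+1) s) =
          chain_ok [seq i.2 | i <- shift s.+2 U].
  rewrite /chain_ok XB; set es : seq nat := [seq i.2 | i <- _].
  have es_ge (w : nat) : w \in es -> (s.+2 <= w)%N.
    by case/mapP=> -[x e] /mapP[i _ [_ ->]] -> /=; lia.
  rewrite !size_rcons -addn2 iotaD all_cat /= andbT add0n.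
  have nth_es k : nth 0%N (rcons (rcons es s.+1) s) (size es + k) =
      nth 0%N [:: s.+1; s] k.
    by rewrite -!cats1 -catA nth_cat ltnNge leq_addr addKn.
  have e0 := nth_es 0%N; have e1 := nth_es 1%N; rewrite addn0 in e0; rewrite addn1 in e1.
  have -> : link_ok m (rcons (rcons es s.+1) s) (size es).
    by rewrite /link_ok e0 e1 /= leqW // subSn //= even_s !size_rcons ltnSn eqxx.
  have -> : link_ok m (rcons (rcons es s.+1) s) (size es).+1.
    by rewrite /link_ok /= e0 e1 /= le_ms (negbTE even_s) eqxx.
  (* The pair does not interfere with the rows above: only excess s+2 could use s+1 as its
     successor, and by parity it looks upwards. *)
  rewrite !andbT; apply: eq_in_all => j; rewrite mem_iota /= add0n => lt_j.
  rewrite link_ok_rcons ?size_rcons; [|exact: ltnW|by lia].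
  apply: link_ok_rcons => // _ _; have := es_ge _ (mem_nth 0%N lt_j).
  case: (nth _ _ _) => // v _; apply: contraTneq => /= ->.
  by rewrite !subSn ?leqW //= negbK.
have -> : (-1) ^+ (s * (size U).+2) = (-1) ^+ (s.+2 * size U) :> R.
  by rewrite -signr_odd -[RHS]signr_odd !oddM /= !negbK.
by ring.
Qed.
End Saturated.
End Transfer.
Notation ups := (count id).

(** * Duality of the two transfers *)

Fixpoint words (n : nat) : seq (seq bool) :=
  if n is k.+1 then [seq b :: w | b <- [:: true; false], w <- words k]
  else [:: [::]].

Lemma mem_words n w : (w \in words n) = (size w == n).
Proof.
elim: n w => [|n IH] w; first by rewrite inE; case: w.
rewrite mem_cat /= cats0; case: w => [|b w] /=.
  by apply/negP => /orP[] /mapP[].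
rewrite eqSS -IH; apply/orP/idP => [|w_in].
  by case=> /mapP[v v_in [_ ->]].
by case: b; [left | right]; apply: map_f.
Qed.

Lemma uniq_words n : uniq (words n).
Proof.
elim: n => // n IH; apply: (@allpairs_uniq _ _ _ cons) => //.
by move=> [x s] [y r] _ _ [-> ->].
Qed.

Section Sums.
Variable R : comNzRingType.

Lemma big_words_tuple n (f : seq bool -> R) :
  \sum_(b : n.-tuple bool) f b = \sum_(w <- words n) f w.
Proof.
rewrite -(big_map (@tval _ _) xpredT f); apply: perm_big; apply: uniq_perm.
- by rewrite map_inj_uniq ?index_enum_uniq //; exact: val_inj.
- exact: uniq_words.
move=> w; rewrite mem_words; apply/mapP/eqP => [[b _ ->]|sz_w].
  exact: size_tuple.
by exists (Tuple (introT eqP sz_w)); rewrite ?mem_index_enum.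
Qed.

Lemma big_words_cons n (f : seq bool -> R) :
  \sum_(w <- words n.+1) f w =
  \sum_(w <- words n) f (true :: w) + \sum_(w <- words n) f (false :: w).
Proof. by rewrite /= cats0 big_cat !big_map. Qed.

Lemma big_words_cat k n (f : seq bool -> R) :
  \sum_(w <- words (k + n)) f w =
  \sum_(u <- words k) \sum_(v <- words n) f (u ++ v).
Proof.
elim: k f => [|k IH] f; first by rewrite big_seq1.
by rewrite addSn !big_words_cons !IH.
Qed.

Lemma big_words_rcons n (f : seq bool -> R) :
  \sum_(w <- words n.+1) f w =
  \sum_(w <- words n) (f (rcons w true) + f (rcons w false)).
Proof.
rewrite -addn1 big_words_cat; apply: eq_bigr => u _.
by rewrite big_words_cons !big_seq1 !cats1.
Qed.

Lemma eq_big_words n (f g : seq bool -> R) :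
  (forall w, size w = n -> f w = g w) ->
  \sum_(w <- words n) f w = \sum_(w <- words n) g w.
Proof.
by move=> fg; apply: eq_big_seq => w; rewrite mem_words => /eqP/fg.
Qed.

Lemma peak_or_ups (w : seq bool) :
  (exists w1 w2, true :: w = w1 ++ true :: false :: w2)
  \/ true :: w = nseq (size w).+1 true.
Proof.
elim: w => [|[] w IH]; [by right| |by left; exists [::], w].
case: IH => [[w1 [w2 e]]|e]; last by right; rewrite /= {1}e.
by left; exists (true :: w1), w2; rewrite e.
Qed.

(** * The duality identity for shifted anchor weights *)

Variables (t tN : R) (X : parameter_case).
Notation FI := (closingI t tN X).
Notation FII := (closingII t tN X).
Notation GI := (genfun t RuleI 1).
Notation GII := (genfun t RuleII (-1)).

(** The shifts that occur: s grows by one up to m and by two from there. *)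
Definition good_shift (s : nat) : bool :=
  if X is CaseB m then (m <= s)%N ==> ~~ odd (s - m) else true.

Lemma duality_peak s x y al1 a1 a2 al2 ga1 ga2 :
  size al1 = size ga1 -> size al2 = size ga2 ->
  \sum_(w <- words (size ga1 + (size ga2).+2))
     GI (FI s) x [::] (al1 ++ a1 :: a2 :: al2) w
     * GII (FII s) y [::] (ga1 ++ true :: false :: ga2) w
  = (a1 && ~~ a2)%:R * t ^+ (ups ga1 - ups al1).*2
    * \sum_(w <- words (size ga1 + size ga2))
        GI (FI s) x [::] (al1 ++ al2) w * GII (FII s) y [::] (ga1 ++ ga2) w.
Proof.
move=> sz1 sz2; rewrite !big_words_cat mulr_sumr; apply: eq_big_words => u szu.
rewrite !big_words_cons -!big_split mulr_sumr /=; apply: eq_big_words => v szv.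
rewrite !genfunII_peak ?szu //=; try exact: closingII_inv.
rewrite genfunI_peak ?sz1 ?szu //; last exact: closingI_inv.
rewrite !add0n !mulr0 add0r addr0 expr0 expr1.
set A := GI _ _ _ _ (u ++ false :: _); set B := GI _ _ _ _ _.
set C := GII _ _ _ _ _.
(* Outside the support one factor vanishes. Inside it the exponents of the two rules add up without
   truncation, and the prefix [u] drops out of the sum. *)
have [lt1|le1] := ltnP (ups u) (ups al1).
  by have -> : B = 0 by [apply: genfunI_lt; rewrite ?sz1]; ring.
have [lt2|le2] := ltnP (ups ga1) (ups u).
  by have -> : C = 0 by [apply: genfunII_lt; rewrite ?szu]; ring.
have -> : (ups ga1 - ups al1 = (ups u - ups al1) + (ups ga1 - ups u))%N by lia.
by rewrite doubleD exprD; ring.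
Qed.

Lemma closingI_nil s : FI s [::] = 1.
Proof.
by rewrite /closingI /closing /= big_nil /even_ok; case: X => *; rewrite mulr1.
Qed.

Lemma closingII_nil s : FII s [::] = 1.
Proof.
rewrite /closingII /closing /= big_nil muln0 /chain_ok.
by case: X => *; rewrite !mulr1.
Qed.

(** For Rule I a final 2 of beta gives c times the final 1 plus a shifted term; for Rule II a final
    1 gives -c times the final 2. The terms with c cancel. *)
Lemma duality_last s n x y al a :
  free_shift X s -> size al = n ->
  \sum_(w <- words n.+1)
     GI (FI s) x [::] (rcons al a) w * GII (FII s) y [::] (nseq n.+1 true) w
  = a%:R * \sum_(w <- words n)
             GI (FI s.+1) x [::] al w * GII (FII s.+1) y [::] (nseq n true) w.
Proof.
move=> fs sza; rewrite big_words_rcons mulr_sumr; apply: eq_big_words => w szw.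
rewrite -[n.+1]addn1 nseqD cats1.
have fI U z : FI s (rcons U (z, 0%N)) = anchor_wt t tN X RuleI s * FI s U.
  exact: closingI_rcons.
have fIb := @closingI_bump R t tN X s.
have fIIb := @closingII_bump R t tN X s.
rewrite (@genfunI_last _ t _ _ _ _ _ _ _ _ fI fIb) ?sza ?szw //.
have fII U z := @closingII_rcons R t tN X s U z fs.
rewrite !(@genfunII_last _ t _ _ _ _ _ _ _ _ fIIb fII) ?size_nseq ?szw //.
by ring.
Qed.

Lemma duality_last2 m s n x y al a1 a2 :
  X = CaseB m -> (m <= s)%N -> ~~ odd (s - m) -> size al = n ->
  \sum_(w <- words n.+2)
     GI (FI s) x [::] (al ++ [:: a1; a2]) w
     * GII (FII s) y [::] (nseq n.+2 true) w
  = (a1 && a2)%:R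
    * \sum_(w <- words n)
        GI (FI s.+2) x [::] al w * GII (FII s.+2) y [::] (nseq n true) w.
Proof.
move=> XB le_ms even_s sza; rewrite -[n.+2]addn2 big_words_cat mulr_sumr.
apply: eq_big_words => w szw; rewrite nseqD !big_words_cons !big_seq1 /=.
have fI := @closingI_rcons2 R t tN X m s XB le_ms even_s.
have fI1 := @closingI_rcons1 R t tN X m s XB le_ms even_s.
have fI0 := @closingI_odd R t tN X m s XB le_ms even_s.
have fIb U : FI s (map (bump_row true) (map (bump_row true) U)) = FI s.+2 U.
  by rewrite !closingI_bump.
rewrite (@genfunI_last2 _ t _ _ _ _ _ _ _ _ _ fI fI1 fI0 fIb) ?sza ?szw //.
have fII := @closingII_bump2 R t tN X s.
have fII2 := @closingII_rcons2 R t tN X m s XB le_ms even_s.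
have fII1 := @closingII_rcons1 R t tN X m s XB le_ms even_s.
rewrite !(@genfunII_last2 _ t _ _ _ _ _ _ _ _ _ fII fII2 fII1) ?size_nseq ?szw //.
by rewrite /=; ring.
Qed.

(** One column left at a saturated shift cannot be removed in pairs, but any strip in it would be
    unpaired under either rule, so it must be empty. *)
Lemma duality_single m s x y a :
  X = CaseB m -> (m <= s)%N -> ~~ odd (s - m) ->
  \sum_(w <- words 1) GI (FI s) x [::] [:: a] w * GII (FII s) y [::] [:: true] w
  = a%:R.
Proof.
move=> XB le_ms even_s; rewrite big_words_cons !big_seq1 /= !transferII /=.
have -> : FII s (step y.+1 true 1 0 [::]) = 0.
  exact: (@closingII_rcons1 R t tN X m s XB le_ms even_s [::] _ 0).
rewrite !mulr0 addr0 closingII_nil expr0 mulr1 transferI.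
case: a => /=; rewrite big_nat1 /= mul1r; first by rewrite closingI_nil mulr1.
by rewrite (@closingI_rcons1 R t tN X m s XB le_ms even_s [::]) // mul0r.
Qed.

Lemma split_last2 k n (al : seq bool) :
  size al = (k + n.+2)%N ->
  exists al1 a1 a2 al2,
    [/\ al = al1 ++ a1 :: a2 :: al2, size al1 = k & size al2 = n].
Proof.
move=> sza; have := cat_take_drop k al; have := size_drop k al.
rewrite sza addKn; case: (drop k al) => [|a1 [|a2 al2]] //= [sz2] <-.
by exists (take k al), a1, a2, al2; split=> //; rewrite size_takel // sza leq_addr.
Qed.

Lemma duality s n x y al ga :
  good_shift s -> size al = n -> size ga = n ->
  \sum_(w <- words n) GI (FI s) x [::] al w * GII (FII s) y [::] ga w
  = (al == ga)%:R.
Proof.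
(* Strong induction, since columns may disappear in pairs; [s] varies because removing final 2's
   raises it. *)
have [k le_nk] := ubnP n; elim: k => // k IH in s n x y al ga le_nk *.
move=> gs sza szg; case: ga szg => [|[] ga] szg.
- rewrite -szg in sza *; case: al sza => // _; rewrite big_seq1 /=.
  by rewrite closingI_nil closingII_nil mulr1.
- have [[ga1 [ga2 ega]]|eg] := peak_or_ups ga.
    rewrite ega size_cat /= in szg *; rewrite -szg in sza le_nk *.
    have [al1 [a1 [a2 [al2 [-> sz1 sz2]]]]] := split_last2 sza.
    rewrite duality_peak // IH ?size_cat ?sz1 ?sz2 //; last by lia.
    rewrite !eqseq_cat //; case: eqP => [->|_] /=; last by ring.
    rewrite subnn expr0 mulr1 -natrM mulnb !eqseq_cons.
    by case: a1; case: a2.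
  rewrite eg; rewrite /= in szg; rewrite szg -szg in eg *.
  have [fs|nfs] := boolP (free_shift X s).
    rewrite -szg in sza le_nk; case/lastP: al sza => // al a.
    rewrite size_rcons => -[sza]; rewrite duality_last // IH ?size_nseq //.
      rewrite -[(size ga).+1]addn1 nseqD cats1.
      rewrite eqseq_rcons -natrM mulnb.
      by rewrite andbC eqb_id.
    move: gs fs; rewrite /good_shift /free_shift; case: (X) => // m _ lt_sm.
    by apply/implyP => le_ms; rewrite (_ : (s.+1 - m)%N = 0%N) //; lia.
  have [m XE] : exists m, X = CaseB m.
    by move: nfs; rewrite /free_shift; case: (X) => // m; exists m.
  have le_ms : (m <= s)%N by move: nfs; rewrite /free_shift XE -leqNgt.
  have even_s : ~~ odd (s - m) by move: gs; rewrite /good_shift XE le_ms.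
  rewrite -szg in sza le_nk.
  case: (size ga) sza le_nk => [|n'] sza le_nk.
    case: al sza => [|a []] // _.
    transitivity (a%:R : R); first exact: (duality_single _ _ _ XE).
    by rewrite eqseq_cons andbT eqb_id.
  have [al1 [a1 [a2 [al2 [eal sz1 sz2]]]]] := @split_last2 n' 0 al ltac:(lia).
  rewrite eal (size0nil sz2) (duality_last2 _ _ _ _ XE) // IH ?size_nseq //.
    rewrite -[n'.+2]addn2 nseqD eqseq_cat ?size_nseq // !eqseq_cons andbT.
    by rewrite -natrM mulnb andbC !eqb_id.
  - by lia.
  - by rewrite /good_shift XE !subSn ?leqW //= negbK even_s.
(* With no row present, a leading 1 of gamma forces the letter 1 in beta, and that forces it in
   alpha. *)
rewrite -szg in sza *; case: al sza => // a al [sza] /=.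
rewrite cats0 big_cat !big_map /=.
rewrite big1 ?add0r => [|w _]; last by rewrite transferII mulr0.
under eq_bigr => w _ do rewrite transferII transferI /= !mul1r.
case: a => /=.
  by rewrite big1 // => w _; rewrite big_nil mul0r.
under eq_bigr => w _ do rewrite big_nat1 /= mul1r.
by rewrite IH //; move: le_nk; rewrite -szg /=.
Qed.
End Sums.

(** * Rows of a region *)

Definition ups_to (s : seq bool) (x : nat) : nat := count id (take x s).

Lemma heightE s x :
  (x <= size s)%N -> height s x = (ups_to s x).*2%:Z - x%:Z.
Proof.
move=> le_x; rewrite /height /ups_to.
have -> : count_mem letter2 (take x s) = count id (take x s).
  by apply: eq_count => -[].
have -> : count_mem letter1 (take x s) = count (predC id) (take x s).
  by apply: eq_count => -[].
by have := count_predC id (take x s); rewrite size_takel //; lia.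
Qed.

Lemma ups_toS s x :
  (x < size s)%N -> ups_to s x.+1 = (ups_to s x + nth false s x)%N.
Proof.
by move=> lt_x; rewrite /ups_to (take_nth false) // -cats1 count_cat /= addn0.
Qed.

Lemma ups_to_le s x : (ups_to s x <= x)%N.
Proof. by apply: leq_trans (count_size _ _) _; rewrite size_take; case: ltnP. Qed.

Lemma ups_to_drop s x k : ups_to (drop x s) k = (ups_to s (x + k) - ups_to s x)%N.
Proof. by rewrite /ups_to takeD count_cat addKn. Qed.

Lemma ups_to_mono s x y : (x <= y)%N -> (ups_to s x <= ups_to s y)%N.
Proof. by move=> le; rewrite -(subnKC le) /ups_to takeD count_cat leq_addr. Qed.

Lemma path_leP N (a b : word N) :
  reflect (forall x, (x <= N)%N -> (ups_to a x <= ups_to b x)%N) (Defs.path_le a b).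
Proof.
have cnt1 (s : word N) x : (x <= N)%N ->
    (count_mem letter1 (take x s) + ups_to s x = x)%N.
  have -> : count_mem letter1 (take x s) = count (predC id) (take x s).
    by apply: eq_count => -[].
  move=> le_x; have := count_predC id (take x s).
  by rewrite size_takel ?size_tuple // addnC.
apply: (iffP forallP) => le_ab x.
  move=> le_x; have := le_ab (Ordinal (le_x : (x < N.+1)%N)) => /=.
  by have /= := cnt1 a x le_x; have /= := cnt1 b x le_x; lia.
have le_x : (x <= N)%N by rewrite -ltnS.
by have /= := le_ab x le_x; have /= := cnt1 a x le_x; have /= := cnt1 b x le_x; lia.
Qed.

Lemma column_gt0 N (b : box N) : (0 < column b)%N. Proof. by []. Qed.

Lemma column_le N (b : box N) : (column b <= N)%N.
Proof. by case: b => x y; rewrite /column /= ltn_ord. Qed.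

Lemma box_inj N (b c : box N) : column b = column c -> level b = level c -> b = c.
Proof.
case: b c => [x y] [x' y']; rewrite /column /level /= => -[/val_inj->] e.
by congr (_, _); apply: val_inj => /=; lia.
Qed.

Lemma box_exists N x (y : int) :
  (0 < x <= N)%N -> `|y| <= N%:Z -> exists b : box N, column b = x /\ level b = y.
Proof.
move=> /andP[x_gt0 le_x] le_y.
have lt_x : (x.-1 < N)%N by lia.
have lt_y : (absz (y + N%:Z)%R < N.*2.+1)%N by lia.
exists (Ordinal lt_x, Ordinal lt_y); rewrite /column /level /=; split; lia.
Qed.

Lemma in_region N (a b : word N) (c : box N) :
  (c \in region a b) =
  [&& `|level c| <= (column c)%:Z, (2 %| (column c)%:Z + level c - 1)%Z,
      height a (column c) <= level c & level c < height b (column c)].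
Proof.
rewrite /region !inE; case: (`|_| <= _); rewrite ?andbF //=.
by case: (_ %| _)%Z; rewrite ?andbF //= -leNgt.
Qed.

Lemma has_posP N (D : {set box N}) (x y : int) :
  reflect (exists2 b, b \in D & (column b)%:Z = x /\ level b = y)
          (has_pos D (x, y)).
Proof.
apply: (iffP imageP) => [[b bD [-> ->]]|[b bD [<- <-]]]; first by exists b.
by exists b.
Qed.

Section Rows.
Variables (N : nat) (Y : rule) (p q : word N).

Definition lower : word N := if Y is RuleI then p else q.
Definition upper_path : word N := if Y is RuleI then q else p.
Definition reg : {set box N} := region lower upper_path.
Definition row_count (x : nat) : nat := (ups_to upper_path x - ups_to lower x)%N.

(* Row 0 is the one next to the base path p. *)
Definition row_level (x j : nat) : int :=
  let h := height p x in if Y is RuleI then h + (j.*2.+1)%:Z else h - (j.*2.+1)%:Z.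

Definition row_of (b : box N) : nat := (`|level b - height p (column b)|%N)./2.

Hypothesis le_paths : Defs.path_le lower upper_path.

Let height_p x : (x <= N)%N -> height p x = (ups_to p x).*2%:Z - x%:Z.
Proof. by move=> le_x; rewrite heightE ?size_tuple. Qed.

Let height_q x : (x <= N)%N -> height q x = (ups_to q x).*2%:Z - x%:Z.
Proof. by move=> le_x; rewrite heightE ?size_tuple. Qed.

Lemma row_level_reg b j :
  (j < row_count (column b))%N -> level b = row_level (column b) j ->
  b \in reg /\ row_of b = j.
Proof.
move=> lt_j eb; have le_x := column_le b.
have := elimT (path_leP _ _) le_paths _ le_x.
have := ups_to_le upper_path (column b).
move: lt_j; rewrite /row_of eb /reg in_region eb /row_count /row_level.
rewrite /lower /upper_path; case: Y => /=; rewrite height_p // height_q //.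
  by move: (column b) => x; lia.
by move: (column b) => x; lia.
Qed.

Lemma regP b :
  b \in reg -> (row_of b < row_count (column b))%N
                /\ level b = row_level (column b) (row_of b).
Proof.
have le_x := column_le b.
have := elimT (path_leP _ _) le_paths _ le_x.
rewrite /row_of /reg in_region /row_count /row_level.
rewrite /lower /upper_path; case: Y => /=; rewrite height_p // height_q //.
  by move: (column b) (level b) => x; lia.
by move: (column b) (level b) => x; lia.
Qed.

Lemma row_exists x j :
  (0 < x <= N)%N -> (j < row_count x)%N ->
  exists b, [/\ b \in reg, column b = x & row_of b = j].
Proof.
move=> x_in; have /andP[x_gt0 le_x] := x_in; move=> lt_j.
have [|b [cb lb]] := @box_exists N x (row_level x j) x_in.
  have := elimT (path_leP _ _) le_paths _ le_x.
  have := ups_to_le upper_path x; move: lt_j; rewrite /row_count /row_level.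
  by rewrite /lower /upper_path; case: Y => /=; rewrite height_p //; lia.
rewrite -cb in lt_j lb; have [b_reg rb] := row_level_reg lt_j lb.
by exists b.
Qed.

Lemma row_inj b c :
  b \in reg -> c \in reg -> column b = column c -> row_of b = row_of c -> b = c.
Proof.
move=> /regP[_ lb] /regP[_ lc] ec er; apply: box_inj => //.
by rewrite lb lc ec er.
Qed.

(** Rules I(a) and II(a) share the consequence that a strip touching another from this side does so
    along its whole length; this direction allows a common treatment. *)
Definition towards_base (x : int * int) : int * int :=
  if Y is RuleI then below x else above x.

Lemma has_pos_towards_base (D : {set box N}) b :
  D \subset reg -> b \in reg ->
  reflect (exists2 u, u \in D & column u = column b /\ row_of b = (row_of u).+1)
          (has_pos D (towards_base (centre b))).
Proof.
move=> /subsetP sD /regP[lt_b lb].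
have -> : towards_base (centre b) =
    ((column b)%:Z, if Y is RuleI then level b - 2 else level b + 2).
  by rewrite /towards_base; case: Y.
apply: (iffP (has_posP _ _ _)) => -[u uD [cu lu]]; exists u => //.
  have {}cu : column u = column b by apply/eqP; rewrite -eqz_nat cu.
  split=> //; have [_] := regP (sD _ uD); rewrite lu lb cu.
  by rewrite /row_level; case: Y; lia.
split; first by rewrite cu.
have [_ ->] := regP (sD _ uD); rewrite lb lu cu.
by rewrite /row_level; case: Y; lia.
Qed.

Definition seg (j x1 x2 : nat) : {set box N} :=
  [set b in reg | (row_of b == j) && (x1 <= column b <= x2)%N].

Lemma in_seg j x1 x2 b :
  (b \in seg j x1 x2) = [&& b \in reg, row_of b == j & (x1 <= column b <= x2)%N].
Proof. by rewrite inE. Qed.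

(* The base path stays weakly above its height at column x1, which the strip
   exceeds by l' in its last column. *)
Definition ballot_run (j x1 x2 l' : nat) : Prop :=
  [/\ (0 < x1 <= x2)%N, (x2 <= N)%N,
      forall y, (x1 <= y <= x2)%N ->
        (j < row_count y /\ (ups_to p x1).*2 + y <= (ups_to p y).*2 + x1)%N
    & ((ups_to p x2).*2 + x1 = (ups_to p x1).*2 + x2 + l')%N].

Lemma strip_seg (D : {set box N}) l l' :
  D \subset reg -> {in D &, forall b c, row_of b = row_of c} -> is_strip_of l l' D ->
  exists j x1, D = seg j x1 (x1 + (l.*2 + l')) /\
               ballot_run j x1 (x1 + (l.*2 + l')) l'.
Proof.
move=> /subsetP sD row_D /existsP[b0 /existsP[w]]; move: (tval w) => {}w.
case/and3P=> /and3P[/eqP szw /eqP hw /forallP w_ge0] /forallP wD /forall_inP Dw.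
set L := (l.*2 + l')%N in szw hw w_ge0 wD Dw *.
have box_at k : (k <= L)%N ->
    exists2 c, c \in D & column c = (column b0 + k)%N
                         /\ level c = level b0 + height w k.
  move=> le_k; have /has_posP[c cD [cc lc]] := wD (Ordinal (le_k : (k < L.+1)%N)).
  by exists c => //; split=> //; apply/eqP; rewrite -eqz_nat cc.
have hw0 : height w 0 = 0 by rewrite /height take0.
have b0D : b0 \in D.
  have [c cD [cc lc]] := box_at 0%N isT.
  by rewrite -(@box_inj _ c b0) // ?cc ?addn0 // lc hw0 addr0.
have hdiff k : (k <= L)%N ->
    [/\ (column b0 + k <= N)%N, (row_of b0 < row_count (column b0 + k))%N &
        height p (column b0 + k) = height p (column b0) + height w k].
  move=> /box_at[c cD [cc lc]]; rewrite -cc column_le.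
  have [lt_c] := regP (sD _ cD); have [lt_b lb] := regP (sD _ b0D).
  rewrite (row_D c b0) // in lt_c * => lc'; split=> //.
  move: lc; rewrite lb lc' /row_level cc; case: Y; lia.
exists (row_of b0), (column b0); split.
  apply/setP=> b; rewrite inE; apply/idP/and3P => [bD|[b_reg /eqP rb]].
    rewrite (sD _ bD) (row_D b b0) ?eqxx //; split=> //.
    have /existsP[k /eqP ek] := Dw _ bD; move/(congr1 fst): ek => /=.
    by have := ltn_ord k; lia.
  case/andP=> le1 le2; have [|c cD [cc _]] := box_at (column b - column b0)%N.
    by lia.
  rewrite (@row_inj b c) //; [exact: sD | lia | by rewrite rb; apply: row_D].
have le_L : (column b0 + L <= N)%N by have [] := hdiff L (leqnn _).
split; first by rewrite column_gt0 leq_addr.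
- exact: le_L.
- move=> y le_y; have [|le_N lt_j hy] := hdiff (y - column b0)%N; first by lia.
  rewrite subnKC in le_N lt_j hy; last by lia.
  split=> //; have lt_k : (y - column b0 < L.+1)%N by lia.
  have := w_ge0 (Ordinal lt_k) => /=; move: hy.
  by rewrite !height_p ?column_le //; lia.
have [_ _] := hdiff L (leqnn _); rewrite hw !height_p ?column_le //; lia.
Qed.

Lemma seg_strip j x1 l l' :
  ballot_run j x1 (x1 + (l.*2 + l')) l' ->
  is_strip_of l l' (seg j x1 (x1 + (l.*2 + l'))).
Proof.
set L := (l.*2 + l')%N; case=> /andP[x1_gt0 _] le_N run_ge run_end.
have szw : size (take L (drop x1 p)) == L.
  by rewrite size_takel // size_drop size_tuple; lia.
pose w : L.-tuple bool := Tuple szw.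
have hw k : (k <= L)%N -> height w k = height p (x1 + k) - height p x1.
  move=> le_k; rewrite heightE ?size_tuple // !height_p; [|lia|lia].
  have -> : ups_to w k = ups_to (drop x1 p) k by rewrite /ups_to /= take_takel.
  by rewrite ups_to_drop; have := @ups_to_mono p x1 (x1 + k) (leq_addr _ _); lia.
have [||b0 [b0_reg cb0 rb0]] := @row_exists x1 j; first by lia.
  by have [] := run_ge x1; lia.
have [lt_b0 lb0] := regP b0_reg; rewrite cb0 rb0 in lt_b0 lb0.
have lev k : (k <= L)%N -> row_level (x1 + k) j = level b0 + height w k.
  by move=> le_k; rewrite hw // lb0 /row_level; case: Y; lia.
apply/existsP; exists b0; apply/existsP; exists w; apply/and3P; split.
- rewrite /is_ballot -/L size_tuple eqxx /=; apply/andP; split.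
    by rewrite hw // !height_p //; lia.
  apply/forallP => k; have le_k : (k <= L)%N by rewrite -ltnS.
  by rewrite hw // !height_p //; have [] := run_ge (x1 + k)%N; lia.
- apply/forallP=> k; have le_k : (k <= L)%N by rewrite -ltnS.
  have [||c [c_reg cc rc]] := @row_exists (x1 + k) j; first by lia.
    by have [] := run_ge (x1 + k)%N; lia.
  apply/has_posP; exists c; first by rewrite inE c_reg rc eqxx /= cc; lia.
  rewrite cc /= cb0; split; first by lia.
  by rewrite -lev //; have [_ ->] := regP c_reg; rewrite cc rc.
apply/forall_inP=> c; rewrite inE => /and3P[c_reg /eqP rc /andP[le1 le2]].
have lt_k : (column c - x1 < L.+1)%N by lia.
apply/existsP; exists (Ordinal lt_k); rewrite /path_pos /centre /= cb0 -lev; last by lia.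
have [_ ->] := regP c_reg; rewrite rc xpair_eqE.
by rewrite subnKC // eqxx andbT; lia.
Qed.

End Rows.

(** * Configurations from link counts *)

Section Runs.
Variable Y : rule.

(** The sequences of link counts that index the terms of the expanded [genfun]. *)
Fixpoint runs (x : nat) (S : state) (ps qs : seq bool) : seq (seq nat) :=
  match ps, qs with
  | p :: ps', q :: qs' =>
      [seq r :: rs | r <- [seq r <- link_counts Y p q (size S) | row_ok p r S],
                     rs <- runs x.+1 (step x.+1 p (next_size Y p q (size S)) r S)
                                ps' qs']
  | _, _ => [:: [::]]
  end.

Fixpoint run_state (x : nat) (S : state) (ps qs : seq bool) (rs : seq nat)
    (k : nat) {struct k} : state :=
  match k, ps, qs, rs with
  | k'.+1, p :: ps', q :: qs', r :: rs' =>
      run_state x.+1 (step x.+1 p (next_size Y p q (size S)) r S) ps' qs' rs' k'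
  | _, _, _, _ => S
  end.

Lemma run_stateS x S ps qs rs k :
  size qs = size ps -> size rs = size ps -> (k < size ps)%N ->
  let S' := run_state x S ps qs rs k in
  run_state x S ps qs rs k.+1 =
  step (x + k).+1 (nth false ps k)
       (next_size Y (nth false ps k) (nth false qs k) (size S'))
       (nth 0%N rs k) S'.
Proof.
elim: k x S ps qs rs => [|k IH] x S [|p ps] [|q qs] [|r rs] //=.
  by rewrite addn0.
move=> [szq] [szr] lt_k; rewrite addnS -addSn -IH //.
Qed.

Lemma uniq_link_counts p q n : uniq (link_counts Y p q n).
Proof.
by case: Y => /=; [exact: iota_uniq | case: p => //; case: ifP].
Qed.

Lemma uniq_runs x S ps qs : uniq (runs x S ps qs).
Proof.
elim: ps qs x S => [|p ps IH] [|q qs] x S //.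
apply: allpairs_uniq_dep => //; first exact/filter_uniq/uniq_link_counts.
by move=> [r1 rs1] [r2 rs2] _ _ [-> ->].
Qed.

Lemma runsP x S ps qs rs :
  size qs = size ps ->
  reflect (size rs = size ps /\ forall k, (k < size ps)%N ->
             let S' := run_state x S ps qs rs k in
             nth 0%N rs k \in link_counts Y (nth false ps k) (nth false qs k)
                                  (size S')
             /\ row_ok (nth false ps k) (nth 0%N rs k) S')
          (rs \in runs x S ps qs).
Proof.
elim: ps qs rs x S => [|p ps IH] [|q qs] rs x S //=.
  by move=> _; rewrite inE; apply: (iffP eqP) => [->|[/size0nil]].
case=> szq; apply: (iffP allpairsPdep) => [[r [rs' [r_in rs'_in ->]]]|].
  have [szr rsP] := elimT (IH _ _ _ _ szq) rs'_in.
  split=> [|[|k] lt_k] /=; [by rewrite szr | | exact: rsP].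
  by move: r_in; rewrite mem_filter => /andP[].
case: rs => [|r rs] [] // [szr] rsP; exists r, rs; split=> //.
  by rewrite mem_filter; have [/= -> ->] := rsP 0%N isT.
by apply/IH => //; split=> // k lt_k; exact: (rsP k.+1).
Qed.

Variables (R : comNzRingType) (t : R).

Fixpoint run_wt (ps : seq bool) (rs : seq nat) : R :=
  match ps, rs with
  | p :: ps', r :: rs' => (if p then 1 else t ^+ r.*2) * run_wt ps' rs'
  | _, _ => 1
  end.

Fixpoint area (n : nat) (ps qs : seq bool) : nat :=
  match ps, qs with
  | p :: ps', q :: qs' =>
      next_size Y p q n + area (next_size Y p q n) ps' qs'
  | _, _ => 0
  end.

Lemma genfun_runs e F x S ps qs :
  genfun t Y e F x S ps qs =
  e ^+ area (size S) ps qs *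
  \sum_(rs <- runs x S ps qs)
     run_wt ps rs * F (run_state x S ps qs rs (size ps)).
Proof.
elim: ps qs x S => [|p ps IH] [|q qs] x S; rewrite /= ?big_seq1 ?expr0 ?mul1r //.
rewrite big_allpairs_dep big_filter /transfer mulr_sumr [RHS]big_mkcond /=.
rewrite !big_seq; apply: eq_bigr => r /link_countsP[le_r le_n _].
case: ifP => // _; rewrite IH size_step // exprD.
have -> : forall A B C D : R, A * B * (C * D) = A * C * (B * D) by move=> *; ring.
by congr (_ * _); rewrite mulr_sumr; apply: eq_bigr => rs _; rewrite mulrA.
Qed.

End Runs.

(** * The partition defined by a valid run *)

Section ValidRun.
Variables (N : nat) (Y : rule) (p q : word N) (rs : seq nat).
Hypothesis rs_valid : rs \in runs Y 0 [::] p q.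

Notation reg := (reg Y p q).
Notation nrows := (row_count Y p q).
Notation row_of := (row_of p).
Notation seg := (seg Y p q).
Notation ballot_run := (ballot_run Y p q).
Notation lnk := (nth 0%N rs).
Notation dir := (nth false p).

Definition run_column (k : nat) : state := run_state Y 0 [::] p q rs k.
Definition row_entry (x j : nat) : nat * nat := nth (0, 0)%N (run_column x) j.

Let runsP_N : size rs = N /\ forall k, (k < N)%N ->
   lnk k \in link_counts Y (dir k) (nth false q k) (size (run_column k))
   /\ row_ok (dir k) (lnk k) (run_column k).
Proof.
have := elimT (runsP _ _ _ _ _) rs_valid; rewrite !size_tuple; exact.
Qed.

Lemma run_colS k : (k < N)%N ->
  run_column k.+1 = step k.+1 (dir k)
    (next_size Y (dir k) (nth false q k) (size (run_column k))) (lnk k) (run_column k).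
Proof.
have [szr _] := runsP_N; move=> lt_k.
by rewrite /run_column run_stateS ?size_tuple ?szr ?add0n.
Qed.

Lemma size_run_col_ups k : (k <= N)%N ->
  (size (run_column k) + ups_to (lower Y p q) k = ups_to (upper_path Y p q) k)%N.
Proof.
elim: k => [|k IH] lt_k; first by rewrite /ups_to !take0 /=; case: N p q.
have [_ /(_ _ lt_k)[/link_countsP[le1 le2 rel] _]] := runsP_N.
rewrite run_colS // size_step // !ups_toS ?size_tuple //.
have := IH (ltnW lt_k); move: rel; rewrite /lower /upper_path.
by case: (Y) => /=; case: (dir k); case: (nth _ q k); lia.
Qed.

Lemma valid_path_le : Defs.path_le (lower Y p q) (upper_path Y p q).
Proof. by apply/path_leP => k /size_run_col_ups; lia. Qed.

Lemma size_run_col k : (k <= N)%N -> size (run_column k) = nrows k.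
Proof. by move=> /size_run_col_ups; rewrite /nrows; lia. Qed.

Lemma lnk_le k : (k < N)%N -> (lnk k <= nrows k)%N /\ (lnk k <= nrows k.+1)%N.
Proof.
move=> lt_k; have [_ /(_ _ lt_k)[/link_countsP[le1 le2 rel] _]] := runsP_N.
by rewrite -(size_run_col lt_k) -(size_run_col (ltnW lt_k)) run_colS // size_step.
Qed.

Let size_take_run k : (k < N)%N -> size (take (lnk k) (run_column k)) = lnk k.
Proof.
move=> lt_k; rewrite size_takel // size_run_col ?(ltnW lt_k) //.
by have [] := lnk_le lt_k.
Qed.

Lemma entry_closed k j :
  (k < N)%N -> (lnk k <= j < nrows k)%N -> (row_entry k j).2 = 0%N.
Proof.
move=> lt_k /andP[le_j lt_j]; have [_ /(_ _ lt_k)[_ /andP[ok _]]] := runsP_N.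
have := all_nthP (0, 0)%N ok (j - lnk k)%N.
rewrite size_drop size_run_col ?(ltnW lt_k) // nth_drop subnKC // => closed.
by apply/eqP/closed; lia.
Qed.

Lemma entry_down k j :
  (k < N)%N -> (j < lnk k)%N -> ~~ dir k -> (0 < (row_entry k j).2)%N.
Proof.
move=> lt_k lt_j down; have [_ /(_ _ lt_k)[_ /andP[_]]] := runsP_N.
rewrite (negbTE down) /= => ok; have := all_nthP (0, 0)%N ok j.
by rewrite size_take_run // nth_take // /closed_row /= -lt0n; apply.
Qed.

Lemma entry_link k j :
  (k < N)%N -> (j < lnk k)%N -> row_entry k.+1 j = bump_row (dir k) (row_entry k j).
Proof.
move=> lt_k lt_j; rewrite /row_entry run_colS // /step nth_cat size_map.
by rewrite size_take_run // lt_j (nth_map (0, 0)%N) ?size_take_run // nth_take.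
Qed.

Lemma entry_new k j :
  (k < N)%N -> (lnk k <= j < nrows k.+1)%N -> row_entry k.+1 j = (k.+1, 0%N).
Proof.
move=> lt_k /andP[le_j lt_j]; have [le_k le_k1] := lnk_le lt_k.
have := lt_j; rewrite -size_run_col //.
rewrite /row_entry run_colS // /step size_cat nth_cat size_map size_nseq.
rewrite size_take_run // [(j < lnk k)%N]ltnNge le_j /= nth_nseq => lt_j'.
by case: ifP => //; lia.
Qed.

Lemma nrows0 : nrows 0 = 0%N.
Proof. by rewrite -size_run_col. Qed.

(** Since its start the entry has been bumped along the base path, and a down step requires positive
    excess, so the truncated predecessor in [bump_row] is exact and the stretch is ballot. *)
Lemma entry_run x j :
  (x <= N)%N -> (j < nrows x)%N ->
  [/\ ballot_run j (row_entry x j).1 x (row_entry x j).2,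
      forall y, ((row_entry x j).1 <= y < x)%N -> (j < lnk y)%N
    & (lnk (row_entry x j).1.-1 <= j)%N].
Proof.
elim: x => [|x IH] lt_x lt_j; first by rewrite nrows0 in lt_j.
have [le_x le_x1] := lnk_le lt_x.
have [lt_r|le_r] := ltnP j (lnk x); last first.
  rewrite entry_new ?le_r //=; split=> // [|y]; last by lia.
  split=> //; [lia | | lia] => y le_y.
  by have -> : y = x.+1 by lia.
have [|[/andP[s_gt0 s_le] le_xN ge_run end_run] lt_run le_s] := IH (ltnW lt_x).
  by lia.
have endE : ((ups_to p x.+1).*2 + (row_entry x j).1 = (ups_to p (row_entry x j).1).*2
              + x.+1 + (row_entry x.+1 j).2)%N.
  rewrite entry_link // ups_toS ?size_tuple //.
  have := @entry_down x j lt_x lt_r; case: (dir x) => /=; first by lia.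
  by move/(_ isT); lia.
have -> : (row_entry x.+1 j).1 = (row_entry x j).1 by rewrite entry_link.
split=> //; last first.
  by move=> y y_in; have [->//|neq] := eqVneq y x; apply: lt_run; lia.
split=> //; first by lia.
move=> y /andP[le_y]; rewrite leq_eqVlt => /predU1P[->|lt_y]; last by apply: ge_run; lia.
by split=> //; lia.
Qed.

Lemma entry_start x y j :
  (x <= y <= N)%N -> (forall z, (x <= z < y)%N -> (j < lnk z)%N) ->
  (row_entry y j).1 = (row_entry x j).1.
Proof.
move=> /andP[le_xy]; rewrite -(subnKC le_xy); elim: (y - x)%N => [|k IH].
  by rewrite addn0.
rewrite addnS => lt_N lt_lnk; rewrite entry_link; [|by []|by apply: lt_lnk; lia].
by rewrite /= IH ?(ltnW lt_N) // => z z_in; apply: lt_lnk; lia.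
Qed.

Lemma run_end x j :
  (x <= N)%N -> (j < nrows x)%N ->
  exists y, [/\ (x <= y <= N)%N, forall z, (x <= z < y)%N -> (j < lnk z)%N,
               (j < nrows y)%N & (y < N)%N -> (lnk y <= j)%N].
Proof.
move=> le_x lt_j; have [k le_k] : exists k, (N - x <= k)%N by exists (N - x)%N.
elim: k x le_x lt_j le_k => [|k IH] x le_x lt_j le_k.
  by exists x; split=> // [|z|]; lia.
have [lt_x|] := ltnP x N; last by exists x; split=> // [|z|]; lia.
have [lt_r|le_r] := ltnP j (lnk x); last by exists x; split=> // [|z]; lia.
have [_ le_x1] := lnk_le lt_x.
have [|||y [y_in lt_lnk lt_y end_y]] := IH x.+1; [by []|by lia|by lia|].
exists y; split=> // [|z z_in]; first by lia.
have [->//|neq] := eqVneq z x; apply: lt_lnk; lia.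
Qed.

(* A strip is determined by its row and its first column. *)
Definition key (b : box N) : nat * nat := (row_of b, (row_entry (column b) (row_of b)).1).
Definition run_conf : {set {set box N}} := preim_partition key reg.

Lemma run_conf_partition : partition run_conf reg.
Proof. exact: preim_partitionP. Qed.

Lemma mem_run_pblock b c :
  b \in reg -> c \in reg -> (c \in pblock run_conf b) = (key b == key c).
Proof.
move=> b_reg c_reg; rewrite pblock_equivalence_partition //.
by move=> x y z _ _ _; split=> //= /eqP->.
Qed.

Notation row_ex := (row_exists valid_path_le).

Lemma reg_rows b : b \in reg -> (row_of b < nrows (column b))%N.
Proof. by case/(regP valid_path_le). Qed.

(** The strip of [b] runs from its recorded start to the first column whose link count does not
    reach its row. *)
Lemma pblock_run_conf b :
  b \in reg ->
  exists y l, let j := row_of b in let s := (key b).2 in let l' := (row_entry y j).2 in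
  [/\ pblock run_conf b = seg j s y, (row_entry y j).1 = s, (column b <= y)%N &
      y = (s + (l.*2 + l'))%N] /\
  [/\ (j < nrows y)%N, (y <= N)%N, (y < N)%N -> (lnk y <= j)%N
    & (y < N)%N -> l' = 0%N].
Proof.
move=> b_reg; have lt_j := reg_rows b_reg; set j := row_of b in lt_j *.
have [y [/andP[le_y le_N] lt_lnk lt_y end_y]] := run_end (column_le b) lt_j.
have sE : (row_entry y j).1 = (key b).2.
  by rewrite (entry_start _ lt_lnk) // le_y.
have [[/andP[s_gt0 s_le] _ ge_run end_run] lnk_run lnk_start] := entry_run le_N lt_y.
rewrite sE in s_gt0 s_le ge_run end_run lnk_run lnk_start.
set s := (key b).2 in sE s_gt0 s_le ge_run end_run lnk_run lnk_start *.
(* The number of down steps is the number of up steps minus the excess. *)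
exists y, (ups_to p y - ups_to p s - (row_entry y j).2)%N => /=; split; split=> //.
- apply/setP=> c; rewrite inE; have [c_reg|c_nreg] /= := boolP (c \in reg); last first.
    apply: contraNF c_nreg => c_in; rewrite -(cover_partition run_conf_partition).
    by apply/bigcupP; exists (pblock run_conf b);
      rewrite ?pblock_mem ?(cover_partition run_conf_partition).
  rewrite mem_run_pblock // xpair_eqE eq_sym; have [ej|//] /= := eqVneq (row_of c) j.
  have [[/andP[_ le_c] _ _ _] lnk_c _] := entry_run (column_le c) (reg_rows c_reg).
  rewrite ej in le_c lnk_c *; apply/eqP/idP => [sc|/andP[le1 le2]].
    have es : s = (row_entry (column c) j).1 := sc.
    rewrite -es in le_c lnk_c; rewrite le_c leqNgt; apply/negP => lt_yc.
    have := lnk_c y; have := column_le c; have := end_y; lia.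
  have := @entry_start (column c) y j; rewrite sE le2 le_N => <- //.
  by move=> z z_in; apply: lnk_run; lia.
- have := @ups_to_drop p s (y - s); have := ups_to_le (drop s p) (y - s).
  by rewrite subnKC //; move: end_run; lia.
by move=> lt_yN; apply: entry_closed; rewrite // end_y.
Qed.

Lemma mem_run_conf D :
  reflect (exists2 b, b \in reg & D = pblock run_conf b) (D \in run_conf).
Proof.
apply: (iffP idP) => [D_in|[b b_reg ->]]; last first.
  by rewrite pblock_mem // (cover_partition run_conf_partition).
have [/eqP cov tI no0] := and3P run_conf_partition.
have [D0|[b bD]] := set_0Vmem D; first by rewrite D0 (negbTE no0) in D_in.
exists b; last by rewrite (def_pblock tI D_in bD).
by rewrite -cov; apply/bigcupP; exists D.
Qed.

Lemma run_conf_block D :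
  D \in run_conf ->
  exists j s y l l',
    [/\ D = seg j s y, strip_length D = (l, l'), is_strip D,
        row_entry y j = (s, l') & y = (s + (l.*2 + l'))%N] /\
    [/\ (j < nrows y)%N, (y <= N)%N, (y < N)%N -> (lnk y <= j)%N
      & (y < N)%N -> l' = 0%N].
Proof.
case/mem_run_conf=> b b_reg ->.
have [y [l /= [[-> sE le_y yE] [lt_j le_N end_y l'0]]]] := pblock_run_conf b_reg.
exists (row_of b), (key b).2, y, l, (row_entry y (row_of b)).2.
have [run _ _] := entry_run le_N lt_j; rewrite sE in run.
set s := (row_entry (column b) _).1 in run sE yE *.
set l' := (row_entry y _).2 in run yE *.
have run' : ballot_run (row_of b) s (s + (l.*2 + l')) l' by rewrite -yE.
have := strip_lengthP (seg_strip valid_path_le run'); rewrite -yE => -[strip_D len_D].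
by split=> //; split=> //; rewrite [LHS]surjective_pairing sE.
Qed.

Lemma run_conf_is_conf : is_conf (lower Y p q) (upper_path Y p q) run_conf.
Proof.
apply/and3P; split; first exact: run_conf_partition.
  by apply/forall_inP => D /run_conf_block[j [s [y [l [l' [[_ _ -> _ _] _]]]]]].
apply/forall_inP => D /run_conf_block[j [s [y [l [l' [[DE lenD _ eE yE]
  [lt_j le_N _ l'0]]]]]]].
apply/implyP; rewrite lenD /= => l'_gt0.
apply/forall_inP => b /andP[bD /forall_inP b_max].
have yN : y = N by apply/eqP; rewrite eqn_leq le_N leqNgt; apply/negP => /l'0; lia.
have [[/andP[s_gt0 s_le] _ _ _] _ _] := entry_run le_N lt_j.
rewrite eE /= in s_gt0 s_le.
have [||c [c_reg cc rc]] := @row_ex y j; [by rewrite yN; lia | by [] |].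
have cD : c \in D by rewrite DE inE c_reg rc eqxx cc s_le leqnn.
by rewrite /is_anchor eqn_leq column_le -{1}yN -cc b_max.
Qed.

End ValidRun.

Lemma big_column (R : Type) (idx : R) (op : Monoid.com_law idx)
    N Y (p q : word N) x (F : nat -> R) :
  Defs.path_le (lower Y p q) (upper_path Y p q) -> (0 < x <= N)%N ->
  \big[op/idx]_(b in reg Y p q | column b == x) F (row_of p b) =
  \big[op/idx]_(j <- iota 0 (row_count Y p q x)) F j.
Proof.
move=> le_pq x_in; rewrite -big_filter.
rewrite -(big_map (row_of p) xpredT F); apply: perm_big; apply: uniq_perm.
- rewrite map_inj_in_uniq; first exact/filter_uniq/index_enum_uniq.
  move=> b c; rewrite !mem_filter => /andP[/andP[b_in /eqP cb] _].
  case/andP=> /andP[c_in /eqP cc] _.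
  by apply: (row_inj le_pq); rewrite ?cb.
- exact: iota_uniq.
move=> j; rewrite mem_iota add0n /=; apply/mapP/idP => [[b]|lt_j].
  by rewrite mem_filter => /andP[/andP[/(regP le_pq)[? _] /eqP <-] _] ->.
have [b [b_reg cb rb]] := row_exists le_pq x_in lt_j.
by exists b; rewrite ?mem_filter ?mem_index_enum ?b_reg ?cb ?eqxx.
Qed.

(** * Nested and anchored strips of a run *)

Section RunConf.
Variables (N : nat) (Y : rule) (p q : word N) (rs : seq nat).
Hypotheses (rs_valid : rs \in runs Y 0 [::] p q) (N_gt0 : (0 < N)%N).

Notation reg := (reg Y p q).
Notation nrows := (row_count Y p q).
Notation row_of := (row_of p).
Notation run_col := (run_column Y p q rs).
Notation entry := (row_entry Y p q rs).
Notation run_conf := (run_conf Y p q rs).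
Let le_paths := valid_path_le rs_valid.

(** Links fill the rows outwards from the base path, so wherever a row is linked the one nearer to
    the base is linked too. *)
Lemma run_nested D b c u v :
  D \in run_conf -> b \in D -> c \in D -> u \in reg -> v \in reg ->
  column u = column b -> row_of b = (row_of u).+1 ->
  column v = column c -> row_of c = (row_of v).+1 -> v \in pblock run_conf u.
Proof.
move=> /(run_conf_block rs_valid)[j [s [y [l [l' [[-> _ _ eE yE] [lt_j le_N _ _]]]]]]].
rewrite !in_seg => /and3P[_ /eqP-> /andP[sb by_]] /and3P[_ /eqP-> /andP[sc cy]].
move=> u_reg v_reg cu ju cv jv; rewrite mem_run_pblock // /key.
rewrite -cu in sb by_; rewrite -cv in sc cy.
have -> : row_of v = row_of u by lia.
rewrite xpair_eqE eqxx /=; have [_ lt_lnk _] := entry_run rs_valid le_N lt_j.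
rewrite eE /= in lt_lnk.
have start x : (s <= x <= y)%N -> (entry x (row_of u)).1 = (entry s (row_of u)).1.
  move=> x_in; apply: (entry_start rs_valid); first by lia.
  by move=> z z_in; have := lt_lnk z; lia.
by rewrite (start (column u)) ?sb // (start (column v)) ?sc.
Qed.

Lemma anchor_pblock b :
  b \in reg -> column b = N ->
  exists l, strip_length (pblock run_conf b) = (l, (entry N (row_of b)).2)
         /\ ((entry N (row_of b)).1 + (l.*2 + (entry N (row_of b)).2) = N)%N.
Proof.
move=> b_reg cb; have bD : b \in pblock run_conf b.
  by rewrite mem_run_pblock.
have D_in : pblock run_conf b \in run_conf by apply/mem_run_conf => //; exists b.
have [j [s [y [l [l' [[DE lenD _ eE yE] [lt_j le_N end_y l'0]]]]]]] :=
  run_conf_block rs_valid D_in.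
move: bD; rewrite {1}DE in_seg cb => /and3P[_ /eqP rb /andP[_ le_y]].
have yN : y = N by lia.
by rewrite yN in eE yE; exists l; rewrite rb eE /= lenD.
Qed.

Lemma anchor_of_length D l l' :
  D \in run_conf -> strip_length D = (l, l') -> (0 < l')%N ->
  exists b, [/\ b \in reg, column b = N, D = pblock run_conf b &
     entry N (row_of b) = (N - (l.*2 + l'), l')%N].
Proof.
move=> D_in lenD l'_gt0; have tI := and3P (run_conf_partition Y p q rs).
have [j [s [y [l1 [l1' [[DE lenD' _ eE yE] [lt_j le_N end_y l'0]]]]]]] :=
  run_conf_block rs_valid D_in.
move: lenD'; rewrite lenD => -[e1 e2]; subst l1 l1'.
have yN : y = N by apply/eqP; rewrite eqn_leq le_N leqNgt; apply/negP => /l'0; lia.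
rewrite yN in eE yE lt_j DE.
have [[/andP[s_gt0 s_le] _ _ _] _ _] := entry_run rs_valid (leqnn N) lt_j.
rewrite eE /= in s_gt0 s_le.
have [||b [b_reg cb rb]] := @row_exists _ _ _ _ le_paths N j; [lia | by [] |].
exists b; split=> //; last by rewrite rb eE; congr (_, _); lia.
have [_ tI' _] := tI; rewrite (def_pblock tI' D_in) //.
by rewrite DE in_seg b_reg rb eqxx cb s_le leqnn.
Qed.

Lemma run_colE : run_col N = [seq entry N j | j <- iota 0 (nrows N)].
Proof.
rewrite -(size_run_col rs_valid) // -[LHS](mkseq_nth (0, 0)%N).
by [].
Qed.

(** By Rule 0 such a strip reaches the last column, where excess and first column determine its
    length and conversely. *)
Lemma strip_count_run l l' :
  (0 < l')%N -> strip_count run_conf l l' =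
                count_mem ((N - (l.*2 + l'))%N, l') (run_col N).
Proof.
move=> l'_gt0; set v := (_, _).
pose B := [set b in reg | (column b == N) && (entry N (row_of b) == v)].
have inB b : (b \in B) = [&& b \in reg, column b == N & entry N (row_of b) == v].
  by rewrite inE.
have -> : strip_count run_conf l l' = #|B|.
  rewrite -(@card_in_imset _ _ (pblock run_conf) B); last first.
    move=> b c; rewrite !inB => /and3P[b_reg /eqP cb _] /and3P[c_reg /eqP cc _] e.
    have : c \in pblock run_conf b by rewrite e mem_run_pblock.
    rewrite mem_run_pblock // xpair_eqE => /andP[/eqP er _].
    by apply: (row_inj le_paths); rewrite ?cb.
  apply: eq_card => D; rewrite inE; apply/andP/imsetP => [[D_in /eqP lenD]|].
    have [b [b_reg cb -> eb]] := anchor_of_length D_in lenD l'_gt0.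
    by exists b; rewrite // inB b_reg cb eb !eqxx.
  case=> b; rewrite inB => /and3P[b_reg /eqP cb /eqP eb ->].
  have [l1 [-> eN]] := anchor_pblock b_reg cb; split.
    by apply/mem_run_conf => //; exists b.
  rewrite eb /= in eN *; apply/eqP; congr (_, _); move: eN; rewrite /v /=.
  have [|[/andP[s_gt0 _] _ _ _] _ _] := entry_run (j := row_of b) rs_valid (leqnn N).
    by have := reg_rows rs_valid b_reg; rewrite cb.
  by rewrite eb /= in s_gt0; lia.
rewrite run_colE count_map -sum1_card.
rewrite (eq_bigl (fun b => (b \in reg) &&
                    ((column b == N) && (entry N (row_of b) == v)))) //.
under eq_bigl => b do rewrite andbA.
pose F j := (if entry N j == v then 1 else 0)%N.
rewrite big_mkcondr (@big_column _ _ _ _ _ _ _ _ F) ?N_gt0 ?leqnn //.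
by rewrite -big_mkcond sum1_count.
Qed.

End RunConf.

(** * Rule I and the weights for the configuration of a run *)

Section RunWeights.
Variables (N : nat) (Y : rule) (p q : word N) (rs : seq nat).
Hypotheses (rs_valid : rs \in runs Y 0 [::] p q) (N_gt0 : (0 < N)%N).

Notation reg := (reg Y p q).
Notation nrows := (row_count Y p q).
Notation row_of := (row_of p).
Notation seg := (seg Y p q).
Notation lnk := (nth 0%N rs).
Notation dir := (nth false p).
Notation run_col := (run_column Y p q rs).
Notation entry := (row_entry Y p q rs).
Notation run_conf := (run_conf Y p q rs).
Let le_paths := valid_path_le rs_valid.
Let row_ex := row_exists le_paths.

Lemma run_conf_sub D : D \in run_conf -> D \subset reg.
Proof.
move=> D_in; rewrite -(cover_partition (run_conf_partition Y p q rs)).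
exact: bigcup_sup.
Qed.

Lemma pblock_run_id D b : D \in run_conf -> b \in D -> pblock run_conf b = D.
Proof.
have [_ tI _] := and3P (run_conf_partition Y p q rs).
by move=> D_in bD; apply: def_pblock.
Qed.

Lemma run_next D b :
  D \in run_conf -> b \in D -> (0 < row_of b)%N ->
  exists u, [/\ u \in reg, column u = column b & row_of b = (row_of u).+1].
Proof.
move=> D_in bD; have b_reg := subsetP (run_conf_sub D_in) _ bD.
have lt_b := reg_rows rs_valid b_reg => row_gt0.
have [||u [u_reg cu ru]] := @row_ex (column b) (row_of b).-1.
- by rewrite column_gt0 column_le.
- by lia.
by exists u; split=> //; rewrite ru prednK.
Qed.

Lemma run_towards_base D D' b c :
  D \in run_conf -> D' \in run_conf -> b \in D' -> c \in D' ->
  has_pos D (towards_base Y (centre b)) -> has_pos D (towards_base Y (centre c)).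
Proof.
move=> D_in D'_in bD' cD'.
have sD := run_conf_sub D_in; have sD' := run_conf_sub D'_in.
case/(has_pos_towards_base le_paths sD (subsetP sD' _ bD')) => u uD [cu ru].
have rc : row_of c = row_of b.
  have [j [s [y [l [l' [[DE _ _ _ _] _]]]]]] := run_conf_block rs_valid D'_in.
  by move: bD' cD'; rewrite DE !in_seg => /and3P[_ /eqP-> _] /and3P[_ /eqP-> _].
have [|v [v_reg cv rv]] := @run_next D' c D'_in cD'; first by rewrite rc ru.
apply/(has_pos_towards_base le_paths sD (subsetP sD' _ cD')).
exists v => //; rewrite -(pblock_run_id D_in uD).
exact: (run_nested rs_valid N_gt0 D'_in bD' cD' (subsetP sD _ uD) v_reg cu ru cv rv).
Qed.

Lemma ruleIa_run : Y = RuleI -> ruleIa run_conf.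
Proof.
move=> YI; apply/forall_inP => D D_in; apply/forall_inP => D' D'_in.
have tb x : below x = towards_base Y x by rewrite YI.
apply/implyP => /exists_inP[b bD' hb]; apply/forall_inP => c cD'.
rewrite tb in hb; rewrite tb.
exact: run_towards_base D_in D'_in bD' cD' hb.
Qed.

Lemma mem_run_colP v :
  v \in run_col N -> exists b, [/\ b \in reg, column b = N & entry N (row_of b) = v].
Proof.
rewrite (run_colE rs_valid) => /mapP[j]; rewrite mem_iota add0n /= => lt_j ->.
have [||b [b_reg cb rb]] := @row_ex N j; rewrite ?N_gt0 ?leqnn //.
by exists b; rewrite rb.
Qed.

(** As [m] is positive, all strips concerned are anchored, hence visible in the last state. *)
Lemma ruleIb_run m :
  (0 < m)%N -> ruleIb m run_conf = even_ok (CaseB m) (run_col N).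
Proof.
move=> m_gt0; apply/forallP/allP => [Ib [s e] v_in|ok l].
  have [b [b_reg cb bv]] := mem_run_colP v_in.
  have [l [lenb eN]] := anchor_pblock rs_valid N_gt0 b_reg cb; rewrite bv /= in lenb eN.
  have [|[/andP[s_gt0 _] _ _ _] _ _] := entry_run (j := row_of b) rs_valid (leqnn N).
    by have := reg_rows rs_valid b_reg; rewrite cb.
  rewrite bv /= in s_gt0; have lt_l : (l < N)%N by lia.
  have lt_l' : (e < N)%N by lia.
  have := forallP (Ib (Ordinal lt_l)) (Ordinal lt_l'); rewrite /=.
  case: leqP => //= le_m; rewrite (strip_count_run rs_valid) //; last by lia.
  have -> : (N - (l.*2 + e) = s)%N by lia.
  by case: ifP => // _; rewrite -leqn0 leqNgt -has_count has_pred1 v_in.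
apply/forallP => l'; apply/implyP => le_m.
rewrite (strip_count_run rs_valid) //; last by lia.
set v := (_, _); have [/ok|] := boolP (v \in run_col N).
  by rewrite /= le_m /= => /andP[/negbTE->].
by move/count_memPn->; case: ifP.
Qed.

Lemma big_seg (R : Type) (idx : R) (op : Monoid.com_law idx) j s y (F : nat -> R) :
  (0 < s)%N -> (y <= N)%N -> (forall x, (s <= x <= y)%N -> (j < nrows x)%N) ->
  \big[op/idx]_(b in seg j s y) F (column b) = \big[op/idx]_(s <= x < y.+1) F x.
Proof.
move=> s_gt0 le_N lt_j; rewrite -big_filter -(big_map (@column N) xpredT F).
apply: perm_big; apply: uniq_perm.
- rewrite map_inj_in_uniq; first exact/filter_uniq/index_enum_uniq.
  move=> b c; rewrite !mem_filter !in_seg => /andP[/and3P[b_in /eqP rb _] _].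
  case/andP=> /and3P[c_in /eqP rc _] _ cbc.
  by apply: (row_inj le_paths) => //; rewrite rb.
- exact: iota_uniq.
move=> x; rewrite mem_index_iota ltnS; apply/mapP/idP => [[b]|x_in].
  by rewrite mem_filter in_seg => /andP[/and3P[_ _ ?] _] ->.
have [||b [b_reg cb rb]] := @row_ex x j; [lia | exact: lt_j |].
by exists b; rewrite ?mem_filter ?mem_index_enum ?in_seg ?b_reg ?rb ?eqxx ?cb ?x_in.
Qed.

Section Weights.
Variables (R : comNzRingType) (t tN : R) (X : parameter_case).
Hypothesis X_ok : admissible t tN X.

Notation awt := (anchor_wt t tN X Y).

Lemma anchor_wt0 : awt 0 = 1.
Proof.
rewrite /anchor_wt; case: X X_ok => [_|m [m_gt0 _]]; rewrite ?/wtA ?/wtB //=.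
by rewrite m_gt0 mulr1.
Qed.

Lemma wtE (D : {set box N}) l l' : strip_length D = (l, l') ->
  wt t tN X Y D = t ^+ l.*2 * awt l' :> R.
Proof.
rewrite /wt /anchor_wt => ->; case: X X_ok => [_|m [m_gt0 _]].
  rewrite /wtA double0 add0n; case: ifP => od; last by rewrite exprD.
  have -> : (l.*2 + l' - 1 = l.*2 + (l' - 1))%N by case: l' od => //; lia.
  by rewrite exprD; ring.
rewrite /wtB double0 add0n addn0; case: ltnP => le_m; first by rewrite !exprD; ring.
by case: ifP => od; rewrite -exprD; congr (_ ^+ _); lia.
Qed.

(** Spreads the weight of a strip over its boxes, so that the product can be regrouped by columns:
    each down step is charged to the box at its right end, the anchor factor to the box in column
    [N]. Step [x.-1] leads into column [x]. *)
Definition box_wt (x j : nat) : R :=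
  (if (j < lnk x.-1)%N && ~~ dir x.-1 then t ^+ 2 else 1)
  * (if x == N then awt (entry N j).2 else 1).

Lemma prod_downs s k : (s + k <= N)%N ->
  exists d, \prod_(s <= z < s + k) (if ~~ dir z then t ^+ 2 else 1) = t ^+ d.*2
         /\ (ups_to p (s + k) + d = ups_to p s + k)%N.
Proof.
elim: k => [|k IH] lt_N.
  by exists 0%N; rewrite addn0 big_geq // expr0 !addn0.
rewrite addnS in lt_N *; have [|d [E1 E2]] := IH; first by lia.
rewrite big_nat_recr ?leq_addr //= E1 ups_toS ?size_tuple //.
case: (dir _) => /=; [exists d | exists d.+1]; split; rewrite ?mulr1 //; try lia.
by rewrite -exprD doubleS addn2.
Qed.

Lemma prod_block D :
  D \in run_conf -> \prod_(b in D) box_wt (column b) (row_of b) = wt t tN X Y D.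
Proof.
case/(run_conf_block rs_valid) => j [s [y [l [l' [[-> lenD _ eE yE]
  [lt_j le_N end_y l'0]]]]]].
have [[/andP[s_gt0 s_le] _ ge_run end_run] lt_lnk le_lnk] := entry_run rs_valid le_N lt_j.
rewrite eE /= in s_gt0 s_le ge_run end_run lt_lnk le_lnk.
rewrite (wtE lenD) (eq_bigr (fun b => box_wt (column b) j)); last first.
  by move=> b; rewrite in_seg => /and3P[_ /eqP->].
rewrite (@big_seg _ _ _ j s y (fun x => box_wt x j)) //; last by move=> x /ge_run[].
rewrite /box_wt big_split /=; congr (_ * _).
  rewrite big_ltn ?ltnS // ltnNge le_lnk /= mul1r big_add1 /=.
  rewrite (eq_big_nat _ _ (F2 := fun z => if ~~ dir z then t ^+ 2 else 1)); last first.
    by move=> z z_in /=; rewrite lt_lnk.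
  have [|d [E1 E2]] := @prod_downs s (y - s); first by lia.
  by rewrite subnKC // in E1 E2; rewrite E1; congr (_ ^+ _); lia.
rewrite big_nat_recr //= big_nat big1 ?mul1r; last first.
  by move=> x x_in; rewrite ifF //; lia.
have [yN|neq] := eqVneq y N; first by rewrite yN in eE; rewrite eE.
by rewrite l'0 ?anchor_wt0 //; lia.
Qed.

Lemma run_wtE (ps : seq bool) (ls : seq nat) : size ls = size ps ->
  run_wt t ps ls = \prod_(0 <= x < size ps)
                     (if nth false ps x then 1 else t ^+ (nth 0%N ls x).*2).
Proof.
elim: ps ls => [|a ps IH] [|r ls] //=; first by rewrite big_geq.
by case=> sz; rewrite big_nat_recl //= IH.
Qed.

Lemma prod_below (r n : nat) (c : R) : (r <= n)%N ->
  \prod_(j <- iota 0 n) (if (j < r)%N then c else 1) = c ^+ r.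
Proof.
move=> le_r; rewrite -{1}(subnKC le_r) iotaD big_cat /= add0n.
have -> : \prod_(j <- iota r (n - r)) (if (j < r)%N then c else 1) = 1.
  by apply: big1_seq => j /=; rewrite mem_iota => /andP[le_j _]; rewrite ltnNge le_j.
rewrite mulr1 (eq_big_seq (fun=> c)); last by move=> j; rewrite mem_iota => /= ->.
by rewrite big_const_seq count_predT size_iota iter_mulr_1.
Qed.

Lemma prod_run_conf :
  \prod_(D in run_conf) wt t tN X Y D =
  run_wt t p rs * \prod_(i <- run_col N) awt i.2.
Proof.
rewrite -(eq_bigr _ (fun D => @prod_block D)).
rewrite -(set_partition_big _ (run_conf_partition Y p q rs)) /=.
rewrite (partition_big (fun b : box N => b.1) xpredT) //=.
have eqp := etrans (size_tuple q) (esym (size_tuple p)).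
have [szr _] := elimT (runsP _ _ _ _ eqp) rs_valid.
rewrite run_wtE // size_tuple.
have -> : \prod_(i <- run_col N) awt i.2 =
          \prod_(x < N) if x.+1 == N then \prod_(i <- run_col N) awt i.2 else 1.
  have lt_N : (N.-1 < N)%N by rewrite prednK.
  rewrite (bigD1 (Ordinal lt_N)) //= prednK // eqxx.
  rewrite [X in _ * X]big1 ?mulr1 // => x.
  rewrite -val_eqE /= => neq; rewrite ifF //; lia.
rewrite big_mkord -big_split /=; apply: eq_bigr => x _.
rewrite (eq_bigl (fun b => (b \in reg) && (column b == x.+1))); last first.
  by move=> b; rewrite /column eqSS.
rewrite (eq_bigr (fun b => box_wt x.+1 (row_of b))); last by move=> b /andP[_ /eqP->].
rewrite (big_column _ _ le_paths); last by rewrite ltn_ord.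
rewrite /box_wt big_split /=; congr (_ * _).
  case: (dir x) => /=.
    by rewrite big1 // => j _; rewrite andbF.
  have [_ le_x1] := lnk_le rs_valid (ltn_ord x).
  under eq_bigr => j _ do rewrite andbT.
  by rewrite prod_below // -exprM mulnC muln2.
case: eqP => [xN|_]; last by rewrite big1.
by rewrite xN (run_colE rs_valid) big_map.
Qed.

End Weights.
End RunWeights.

(** Where the counts differ, take the smaller one as row index: one run joins the boxes of that row
    across the two columns, the other starts a new strip there. *)
Lemma run_conf_inj N Y (p q : word N) rs rs' :
  rs \in runs Y 0 [::] p q -> rs' \in runs Y 0 [::] p q ->
  run_conf Y p q rs = run_conf Y p q rs' -> rs = rs'.
Proof.
have le_lnk (ls ls' : seq nat) x : ls \in runs Y 0 [::] p q ->
    ls' \in runs Y 0 [::] p q -> run_conf Y p q ls = run_conf Y p q ls' ->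
    (x < N)%N -> (nth 0 ls x <= nth 0 ls' x)%N.
  move=> ls_v ls'_v eC lt_x; rewrite leqNgt; apply/negP => lt_ls.
  set j := nth 0%N ls' x in lt_ls.
  have [le1 le2] := lnk_le ls_v lt_x.
  have x_gt0 : (0 < x)%N.
    by rewrite lt0n; apply/eqP => x0; move: le1 lt_ls; rewrite x0 (nrows0 ls_v); lia.
  have le_p := valid_path_le ls_v.
  have [||b [b_reg cb rb]] := @row_exists _ _ _ _ le_p x j; [lia | lia |].
  have [||c [c_reg cc rc]] := @row_exists _ _ _ _ le_p x.+1 j; [lia | lia |].
  have := mem_run_pblock ls b_reg c_reg; rewrite eC mem_run_pblock // /key.
  rewrite cb cc rb rc !xpair_eqE eqxx /= (entry_link ls_v) //= eqxx.
  rewrite (entry_new ls'_v) //=; last by lia.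
  have [|[/andP[_ s_le] _ _ _] _ _] := entry_run (j := j) ls'_v (ltnW lt_x); first by lia.
  by move/eqP; lia.
move=> v v' e; have eqp := etrans (size_tuple q) (esym (size_tuple p)).
have [szr _] := elimT (runsP _ _ _ _ eqp) v.
have [szr' _] := elimT (runsP _ _ _ _ eqp) v'.
apply: (@eq_from_nth _ 0%N) => [|x]; first by rewrite szr.
rewrite szr size_tuple => lt_x; apply/eqP; rewrite eqn_leq.
by rewrite !le_lnk.
Qed.

(** * Rule II for the configuration of a run *)

Section RunConfII.
Variables (N : nat) (p q : word N) (rs : seq nat).
Hypotheses (rs_valid : rs \in runs RuleII 0 [::] p q) (N_gt0 : (0 < N)%N).

Notation reg := (reg RuleII p q).
Notation nrows := (row_count RuleII p q).
Notation row_of := (row_of p).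
Notation lnk := (nth 0%N rs).
Notation dir := (nth false p).
Notation run_col := (run_column RuleII p q rs).
Notation entry := (row_entry RuleII p q rs).
Notation run_conf := (run_conf RuleII p q rs).
Let le_paths := valid_path_le rs_valid.
Let row_ex := row_exists le_paths.

(** Under Rule II exactly the rows present in both columns are linked. *)
Lemma lnk_RuleII x : (x < N)%N ->
  lnk x = (if dir x then nrows x else nrows x.+1)
  /\ (nrows x.+1 + nth false q x = nrows x + dir x)%N.
Proof.
move=> lt_x; have eqp := etrans (size_tuple q) (esym (size_tuple p)).
have [_ rsP] := elimT (runsP _ _ _ _ eqp) rs_valid.
have [|/[dup] r_in /link_countsP[_ _ rel] _] := rsP x; first by rewrite size_tuple.
have := run_colS rs_valid lt_x; move/(congr1 size).
have [szx szx1] := (size_run_col rs_valid (ltnW lt_x), size_run_col rs_valid lt_x).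
rewrite szx1; have [le1 le2] := lnk_le rs_valid lt_x.
rewrite -/(run_column RuleII p q rs x) szx in r_in rel *.
move: r_in rel; rewrite /=; case: (dir x) => /=.
  by rewrite inE => /eqP -> rel; rewrite size_step ?szx //=; lia.
case: ifP => // le_q; rewrite inE => /eqP -> rel.
by rewrite size_step ?szx //=; lia.
Qed.

Lemma run_linked x j b c :
  (x < N)%N -> (j < lnk x)%N -> b \in reg -> c \in reg ->
  column b = x -> column c = x.+1 -> row_of b = j -> row_of c = j ->
  c \in pblock run_conf b.
Proof.
move=> lt_x lt_j b_reg c_reg cb cc rb rc.
by rewrite mem_run_pblock // /key cb cc rb rc entry_link // xpair_eqE !eqxx.
Qed.

Lemma has_pos_self (D : {set box N}) b x y :
  b \in D -> (column b)%:Z = x -> level b = y -> has_pos D (x, y).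
Proof. by move=> bD cb lb; apply/has_posP; exists b. Qed.

Let height_p x : (x <= N)%N -> height p x = (ups_to p x).*2%:Z - x%:Z.
Proof. by move=> le_x; rewrite heightE ?size_tuple. Qed.

(* Around a strip D, every position is in D, in the strip carrying the row
   just above D, or above the upper path. *)
Lemma upper_position D c z :
  D \in run_conf -> c \in D -> z \in upper (centre c) -> z.1 <= N%:Z ->
  [\/ has_pos D z,
      exists u, [/\ u \in reg, column u = column c, row_of c = (row_of u).+1
                  & has_pos (pblock run_conf u) z]
    | row_of c = 0%N /\ forall u, u \in reg -> centre u != z].
Proof.
move=> D_in cD z_in le_z; have c_reg := subsetP (run_conf_sub D_in) _ cD.
have Dc := pblock_run_id D_in cD; have [lt_j lc] := regP le_paths c_reg.
have [x xE] : exists x, x = column c by exists (column c).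
have [j rE] : exists j, j = row_of c by exists (row_of c).
rewrite -xE -rE in lt_j lc *.
have no_pos x' y : row_level RuleII p x' 0 < y ->
    forall u, u \in reg -> centre u != (x'%:Z, y).
  move=> lt_y u /(regP le_paths)[_ lu]; apply/eqP => e.
  have /= cu := congr1 fst e; have /= lu' := congr1 snd e.
  have {}cu : column u = x' by lia.
  by move: lt_y; rewrite -lu' lu cu /row_level; lia.
have le_x : (x <= N)%N by rewrite xE column_le.
have x_gt0 : (0 < x)%N by rewrite xE.
have same_block u v : u \in reg -> v \in pblock run_conf u ->
    pblock run_conf v = pblock run_conf u.
  by move=> u_reg; apply: pblock_run_id; apply/mem_run_conf => //; exists u.
have in_own u : u \in reg -> u \in pblock run_conf u.
  by move=> u_reg; rewrite mem_run_pblock.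
have row_above k : j = k.+1 -> exists u, [/\ u \in reg, column u = x & row_of u = k].
  by move=> jk; apply: row_ex; [rewrite x_gt0 | lia].
have via_above k v z' : j = k.+1 -> v \in reg -> row_of v = k ->
    (forall u, u \in reg -> column u = x -> row_of u = k ->
       pblock run_conf u = pblock run_conf v) -> centre v = z' ->
    exists u, [/\ u \in reg, column u = x, j = (row_of u).+1
                & has_pos (pblock run_conf u) z'].
  move=> jk v_reg rv same <-; have [u [u_reg cu ru]] := row_above k jk.
  exists u; split; rewrite ?ru // (same u) //; apply/has_posP.
  by exists v; rewrite ?in_own.
(* The position just above is in the row nearer to the base. NW is in that row if the base path
   comes up into the column and in the row of [c] if it comes down; for NE, with the outgoing step,
   it is the other way round. *)
move: z_in le_z; rewrite !inE => /or3P[] /eqP -> /= le_z.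
- case jE: j => [|k].
    constructor 3; split=> //; apply: no_pos.
    by rewrite /= -xE lc jE /row_level; lia.
  have [u [u_reg cu ru]] := row_above k jE.
  constructor 2; rewrite -jE; apply: (via_above k u) => //.
    by move=> u' u'_reg cu' ru'; rewrite (row_inj le_paths u'_reg u_reg) ?cu ?ru.
  have [_ lu] := regP le_paths u_reg.
  rewrite /centre /above /= -xE cu lu lc cu ru jE /row_level; congr (_, _); lia.
- have lt_w : (x.-1 < N)%N by lia.
  have hx := @ups_toS p x.-1; rewrite prednK // size_tuple in hx.
  have {}hx := hx le_x.
  have hpw := height_p (ltnW lt_w); have hpx := height_p le_x.
  have := lnk_RuleII lt_w; have := lnk_le rs_valid lt_w; rewrite prednK //.
  have zE : NW (centre c) = ((x.-1)%:Z, level c + 1).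
    by rewrite /NW /= -xE; congr (_, _); lia.
  have w_gt0 : (0 < nrows x.-1)%N -> (0 < x.-1)%N.
    by case: (x.-1) => //; rewrite (nrows0 rs_valid).
  case dw: (dir x.-1) hx => /= hx [le_w le_w1] [lnkE nE].
    case jE: j => [|k].
      constructor 3; split=> //; rewrite zE; apply: no_pos.
      by rewrite lc jE /row_level; lia.
    have lt_k : (k < nrows x.-1)%N by lia.
    have [||v [v_reg cv rv]] := @row_ex x.-1 k; [by rewrite w_gt0; lia | by [] |].
    constructor 2; rewrite -jE; apply: (via_above k v) => //.
      move=> u u_reg cu ru; apply: same_block => //.
      by apply: (run_linked lt_w) v_reg u_reg cv _ rv ru; [lia | rewrite prednK].
    rewrite zE /centre cv; have [_ ->] := regP le_paths v_reg.
    by rewrite lc cv rv jE /row_level; congr (_, _); lia.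
  have lt_j' : (j < nrows x.-1)%N by lia.
  have [||v [v_reg cv rv]] := @row_ex x.-1 j; [by rewrite w_gt0; lia | by [] |].
  have c_in : c \in pblock run_conf v.
    by apply: (run_linked lt_w) v_reg c_reg cv _ rv _; rewrite ?prednK //; lia.
  constructor 1; rewrite zE -Dc (same_block v c) //.
  apply: has_pos_self (in_own v v_reg) _ _.
    by rewrite cv.
  have [_ ->] := regP le_paths v_reg.
  by rewrite lc cv rv /row_level; lia.
have lt_x : (x < N)%N by lia.
have hx := @ups_toS p x; rewrite size_tuple in hx; have {}hx := hx lt_x.
have hpx := height_p le_x; have hpx1 := height_p lt_x.
have := lnk_RuleII lt_x; have := lnk_le rs_valid lt_x.
have zE : NE (centre c) = ((x.+1)%:Z, level c + 1).
  by rewrite /NE /= -xE; congr (_, _); lia.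
case dw: (dir x) hx => /= hx [le_x0 le_x1] [lnkE nE].
  have [||v [v_reg cv rv]] := @row_ex x.+1 j; [by [] | by lia |].
  have v_in : v \in pblock run_conf c.
    by apply: (run_linked lt_x) c_reg v_reg _ cv _ rv; rewrite -?xE -?rE //; lia.
  constructor 1; rewrite zE -Dc; apply: has_pos_self v_in _ _; first by rewrite cv.
  have [_ ->] := regP le_paths v_reg.
  by rewrite lc cv rv /row_level; lia.
case jE: j => [|k].
  constructor 3; split=> //; rewrite zE; apply: no_pos.
  by rewrite lc jE /row_level; lia.
have [||v [v_reg cv rv]] := @row_ex x.+1 k; [by [] | by lia |].
constructor 2; rewrite -jE; apply: (via_above k v) => //.
  move=> u u_reg cu ru; symmetry; apply: same_block => //.
  by apply: (run_linked lt_x) u_reg v_reg cu cv ru rv; lia.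
rewrite zE /centre cv; have [_ ->] := regP le_paths v_reg.
by rewrite lc cv rv jE /row_level; congr (_, _); lia.
Qed.

Lemma has_pos_inj D D' z :
  D \in run_conf -> D' \in run_conf -> has_pos D z -> has_pos D' z -> D = D'.
Proof.
move=> D_in D'_in; case: z => x y /has_posP[b bD [cb lb]] /has_posP[c cD' [cc lc]].
have bc : b = c by apply: box_inj; [lia | rewrite lb].
by rewrite -(pblock_run_id D_in bD) bc (pblock_run_id D'_in cD').
Qed.

Lemma run_same_row D b c : D \in run_conf -> b \in D -> c \in D -> row_of b = row_of c.
Proof.
move=> /(run_conf_block rs_valid)[j [s [y [l [l' [[-> _ _ _ _] _]]]]]].
by rewrite !in_seg => /and3P[_ /eqP-> _] /and3P[_ /eqP-> _].
Qed.

Lemma ruleIIa_run : ruleIIa run_conf.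
Proof.
apply/forall_inP => D D_in; apply/forall_inP => D' D'_in; apply/implyP => neqD.
apply/implyP => /exists_inP[b bD /hasP[z z_in z_D']].
have in_reg E u : E \in run_conf -> u \in E -> u \in reg.
  by move=> E_in; apply: (subsetP (run_conf_sub E_in)).
have le_z : z.1 <= N%:Z.
  by case: z z_D' {z_in} => x y /has_posP[u _ [<- _]] /=; have := column_le u; lia.
case: (upper_position D_in bD z_in le_z) => [z_D|[u [u_reg cu ru z_u]]|[_ no_z]].
- by rewrite (has_pos_inj D'_in D_in z_D' z_D) eqxx in neqD.
- have u_in : pblock run_conf u \in run_conf by apply/mem_run_conf => //; exists u.
  rewrite (has_pos_inj D'_in u_in z_D' z_u) {D' D'_in neqD z_D'}.
  apply/forall_inP => c cD; apply/allP => z' z'_in; apply/implyP => le_z'.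
  case: (upper_position D_in cD z'_in le_z') => [->//|[v [v_reg cv rv z_v]]|[rc _]].
    have v_u := run_nested rs_valid N_gt0 D_in bD cD u_reg v_reg cu ru cv rv.
    by rewrite (pblock_run_id u_in v_u) in z_v; rewrite z_v orbT.
  by have := run_same_row D_in bD cD; rewrite rc ru.
case: z z_D' no_z {z_in le_z} => x y /has_posP[u uD' [cu lu]] no_z.
by have := no_z u (in_reg _ _ D'_in uD'); rewrite /centre cu lu eqxx.
Qed.

Lemma just_belowP E D :
  E \in run_conf -> D \in run_conf ->
  reflect (exists u b, [/\ u \in E, b \in D, column u = column b
                         & row_of u = (row_of b).+1])
          (just_below E D).
Proof.
move=> E_in D_in; have sub G g : G \in run_conf -> g \in G -> g \in reg.
  by move=> G_in; apply: (subsetP (run_conf_sub G_in)).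
have lev u b : u \in E -> b \in D -> column u = column b ->
    (level u = level b - 2) <-> (row_of u = (row_of b).+1).
  move=> uE bD cub; have [_ ->] := regP le_paths (sub E u E_in uE).
  have [_ ->] := regP le_paths (sub D b D_in bD).
  by rewrite cub /row_level; split; lia.
apply: (iffP exists_inP) => [[b bD /has_posP[u uE [cu lu]]]|[u [b [uE bD cub rub]]]].
  have cub : column u = column b by apply/eqP; rewrite -eqz_nat cu.
  by exists u, b; split=> //; apply/lev.
exists b => //; apply/has_posP; exists u => //; split; first by rewrite cub.
exact/lev.
Qed.

(** Nesting again: the inner strip covers the outer one. This supplies the comparison of l and l''
    in Rule II(b). *)
Lemma entry_start_mono j k :
  (j <= k)%N -> (k < nrows N)%N -> ((entry N j).1 <= (entry N k).1)%N.
Proof.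
move=> le_jk lt_k.
have [[/andP[s_gt0 s_le] _ ge_run _] lt_lnk _] := entry_run rs_valid (leqnn N) lt_k.
set s := (entry N k).1 in s_gt0 s_le ge_run lt_lnk *.
have lt_js : (j < nrows s)%N by have [] := ge_run s; lia.
have [[/andP[_ le_s] _ _ _] _ _] := entry_run rs_valid s_le lt_js.
rewrite (entry_start rs_valid (x := s)) ?s_le ?leqnn //.
by move=> z z_in; have := lt_lnk z z_in; lia.
Qed.

Lemma ruleIIb_run m :
  (0 < m)%N -> ruleIIb m run_conf = chain_ok (CaseB m) (map snd (run_col N)).
Proof.
move=> m_gt0; rewrite /chain_ok size_map (size_run_col rs_valid) //.
have sz := size_run_col rs_valid (leqnn N).
have nthE j : (j < nrows N)%N -> nth 0%N (map snd (run_col N)) j = (entry N j).2.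
  by move=> lt_j; rewrite (nth_map (0, 0)%N) ?sz.
have rowb b : b \in reg -> column b = N -> (row_of b < nrows N)%N.
  by move=> b_reg cb; have := reg_rows rs_valid b_reg; rewrite cb.
have own u : u \in reg -> u \in pblock run_conf u.
  by move=> u_reg; rewrite mem_run_pblock.
have pb_in u : u \in reg -> pblock run_conf u \in run_conf.
  by move=> u_reg; apply/mem_run_conf => //; exists u.
apply/forall_inP/allP => [IIb j|ok D D_in].
  rewrite mem_iota add0n => /= lt_j; rewrite /link_ok size_map sz.
  have [||b [b_reg cb rb]] := @row_ex N j; rewrite ?N_gt0 ?leqnn //.
  have [l [lenb eN]] := anchor_pblock rs_valid N_gt0 b_reg cb; rewrite rb in lenb eN.
  rewrite nthE //; apply/implyP => le_m.
  have := IIb _ (pb_in b b_reg); rewrite lenb => /implyP/(_ le_m).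
  case: ifP => od /exists_inP[E E_in /and3P[_ /eqP E2 jb]].
    have l'_gt0 : (0 < (strip_length E).2)%N.
      by rewrite E2; move: od le_m; case: (_.2) => [|[|n]] //; lia.
    have [c [c_reg cc Ec ec]] :=
      anchor_of_length rs_valid N_gt0 E_in (surjective_pairing _) l'_gt0.
    have /just_belowP[//||u [d [uE dD _ rud]]] := jb; first exact: pb_in.
    rewrite Ec in uE E_in; rewrite (run_same_row E_in uE (own c c_reg)) in rud.
    rewrite (run_same_row (pb_in b b_reg) dD (own b b_reg)) rb in rud.
    by have := rowb c c_reg cc; rewrite rud => lt_j1; rewrite lt_j1 nthE // -rud ec /= E2.
  have l'_gt0 : (0 < (strip_length E).2)%N by rewrite E2.
  have [c [c_reg cc Ec ec]] :=
    anchor_of_length rs_valid N_gt0 E_in (surjective_pairing _) l'_gt0.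
  have /just_belowP[|//|u [d [uD dE _ rud]]] := jb; first exact: pb_in.
  rewrite Ec in dE E_in; rewrite (run_same_row E_in dE (own c c_reg)) in rud.
  rewrite (run_same_row (pb_in b b_reg) uD (own b b_reg)) rb in rud.
  have lt_j1 := rowb c c_reg cc.
  have ec2 : (entry N (row_of c)).2 = (entry N j).2.+1 by rewrite ec /= E2.
  by rewrite rud in ec2 *; rewrite /= nthE // ec2.
case lenD: (strip_length D) => [l l']; apply/implyP => le_m.
have l'_gt0 : (0 < l')%N by lia.
have [b [b_reg cb Db eb]] := anchor_of_length rs_valid N_gt0 D_in lenD l'_gt0.
have lt_j := rowb b b_reg cb; have := ok (row_of b).
rewrite mem_iota add0n lt_j /link_ok nthE // eb /= le_m size_map sz => /(_ isT).
have [l2 [lenb eN]] := anchor_pblock rs_valid N_gt0 b_reg cb.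
move: lenb; rewrite -Db lenD eb => -[el]; subst l2.
case: ifP => od /andP[lt_j1].
  rewrite nthE // => /eqP ej1.
  have [||c [c_reg cc rc]] := @row_ex N (row_of b).+1; rewrite ?N_gt0 ?leqnn //.
  have [l1 [lenc eNc]] := anchor_pblock rs_valid N_gt0 c_reg cc.
  have := entry_start_mono (leqnSn _) lt_j1 => le_s.
  apply/exists_inP; exists (pblock run_conf c); first exact: pb_in.
  rewrite lenc rc ej1 eqxx /=; apply/andP; split.
    (* Both strips end in column [N], and the lower one starts no earlier, with excess smaller by
       one; so 2l'' <= 2l + 1, and parity gives l'' <= l. *)
    by rewrite rc ej1 in eNc; rewrite eb /= in eN le_s; lia.
  apply/just_belowP; [exact: pb_in | exact: D_in |].
  by exists c, b; split; rewrite ?own ?cc ?cb // Db own.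
have j1E : (row_of b).-1.+1 = row_of b by rewrite prednK.
have lt_j1' : ((row_of b).-1 < nrows N)%N by lia.
rewrite nthE // => /eqP ej1.
have [||c [c_reg cc rc]] := @row_ex N (row_of b).-1; rewrite ?N_gt0 ?leqnn //.
have [l1 [lenc eNc]] := anchor_pblock rs_valid N_gt0 c_reg cc.
have := entry_start_mono (leq_pred (row_of b)) lt_j => le_s.
apply/exists_inP; exists (pblock run_conf c); first exact: pb_in.
rewrite lenc rc ej1 eqxx /=; apply/andP; split.
  by rewrite rc ej1 in eNc; rewrite eb /= in eN le_s; lia.
apply/just_belowP; [exact: D_in | exact: pb_in |].
by exists b, c; split; rewrite ?own ?cc ?cb ?rc // Db own.
Qed.
End RunConfII.

(** * Link counts from configurations *)

Lemma nth_step x up n r S j :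
  (r <= size S)%N -> (j < n)%N ->
  nth (0, 0)%N (step x up n r S) j =
  if (j < r)%N then bump_row up (nth (0, 0)%N S j) else (x, 0%N).
Proof.
move=> le_r lt_j; rewrite /step nth_cat size_map size_takel //.
case: ltnP => lt_jr; last by rewrite nth_nseq ifT //; lia.
by rewrite (nth_map (0, 0)%N) ?size_takel // nth_take.
Qed.

Lemma strip_column_inj N (D : {set box N}) b c :
  is_strip D -> b \in D -> c \in D -> column b = column c -> b = c.
Proof.
case/existsP=> l /existsP[l' /existsP[b0 /existsP[w /and3P[_ _ /forall_inP Dw]]]].
move=> /Dw/existsP[i /eqP ei] /Dw/existsP[k /eqP ek] e.
have ik : i = k :> nat.
  have /= := congr1 fst ei; have /= := congr1 fst ek; lia.
apply: box_inj => //; have /= -> := congr1 snd ei; have /= -> := congr1 snd ek.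
by rewrite ik.
Qed.

Lemma nrowsS N Y (p q : word N) x :
  Defs.path_le (lower Y p q) (upper_path Y p q) -> (x < N)%N ->
  next_size Y (nth false p x) (nth false q x) (row_count Y p q x) = row_count Y p q x.+1.
Proof.
move=> le_paths lt_x; have := elimT (path_leP _ _) le_paths x.+1 lt_x.
have := elimT (path_leP _ _) le_paths x (ltnW lt_x).
rewrite /row_count /next_size /lower /upper_path.
by case: Y {le_paths}; rewrite !ups_toS ?size_tuple //;
  case: (nth _ p x); case: (nth _ q x) => /=; lia.
Qed.

Section ConfRun.
Variables (N : nat) (Y : rule) (p q : word N) (C : {set {set box N}}).
Hypotheses (le_paths : Defs.path_le (lower Y p q) (upper_path Y p q))
  (conf_C : is_conf (lower Y p q) (upper_path Y p q) C)
  (closed_C : forall D D' b c, D \in C -> D' \in C -> b \in D' -> c \in D' ->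
     has_pos D (towards_base Y (centre b)) ->
     has_pos D (towards_base Y (centre c))).

Notation reg := (reg Y p q).
Notation nrows := (row_count Y p q).
Notation row_of := (row_of p).
Notation seg := (seg Y p q).
Notation ballot_run := (ballot_run Y p q).
Notation dir := (nth false p).
Let row_ex := row_exists le_paths.

Let part_C : partition C reg.
Proof. by case/and3P: conf_C. Qed.

Let sub_C D : D \in C -> D \subset reg.
Proof. by move=> D_in; rewrite -(cover_partition part_C); apply: bigcup_sup. Qed.

Let own b : b \in reg -> b \in pblock C b.
Proof. by move=> b_reg; rewrite mem_pblock (cover_partition part_C). Qed.

Let pb_in b : b \in reg -> pblock C b \in C.
Proof. by move=> b_reg; rewrite pblock_mem // (cover_partition part_C). Qed.

Let pb_id D b : D \in C -> b \in D -> pblock C b = D.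
Proof. by have [_ tI _] := and3P part_C; move=> D_in; apply: def_pblock. Qed.

Let next_row b j : b \in reg -> row_of b = j.+1 ->
  exists u, [/\ u \in reg, column u = column b & row_of u = j].
Proof.
move=> b_reg rb; have [lt_b _] := regP le_paths b_reg.
by apply: row_ex; [rewrite column_gt0 column_le | lia].
Qed.

Lemma closed_row_rel D b c u :
  D \in C -> b \in D -> c \in D -> u \in reg -> column u = column b ->
  row_of b = (row_of u).+1 ->
  exists v, [/\ v \in pblock C u, column v = column c & row_of c = (row_of v).+1].
Proof.
move=> D_in bD cD u_reg cu ru.
have b_reg := subsetP (sub_C D_in) _ bD; have c_reg := subsetP (sub_C D_in) _ cD.
have hb : has_pos (pblock C u) (towards_base Y (centre b)).
  apply/(has_pos_towards_base le_paths (sub_C (pb_in u_reg)) b_reg).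
  by exists u; rewrite ?own.
have := closed_C (pb_in u_reg) D_in bD cD hb.
case/(has_pos_towards_base le_paths (sub_C (pb_in u_reg)) c_reg) => v vE [cv rv].
by exists v.
Qed.

(** Induction on the row: the strip next to [D] towards the base touches every box of [D] and lies
    in one row by induction. A strip with a box in row 0 has no such neighbour, so none of its boxes
    can have one. *)
Lemma conf_same_row D b c : D \in C -> b \in D -> c \in D -> row_of b = row_of c.
Proof.
move: D b c; suff H j D b c :
    D \in C -> b \in D -> c \in D -> row_of b = j -> row_of c = j.
  by move=> D b c D_in bD cD; rewrite (H (row_of b) D b c).
elim: j D b c => [|j IH] D b c D_in bD cD rb.
  case rc: (row_of c) => [//|k].
  have [u [u_reg cu ru]] := next_row (subsetP (sub_C D_in) _ cD) rc.
  have [|v [_ _]] := closed_row_rel D_in cD bD u_reg cu; first by rewrite rc ru.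
  by rewrite rb.
have [u [u_reg cu ru]] := next_row (subsetP (sub_C D_in) _ bD) rb.
have [|v [vE cv ->]] := closed_row_rel D_in bD cD u_reg cu; first by rewrite rb ru.
by rewrite (IH _ u v (pb_in u_reg) (own u_reg) vE ru).
Qed.

Lemma conf_seg D : D \in C ->
  exists j s y l', [/\ D = seg j s y, ballot_run j s y l' & (y < N)%N -> l' = 0%N].
Proof.
move=> D_in; have [_ /forall_inP strips /forall_inP r0] := and3P conf_C.
have /existsP[l /existsP[l' D_strip]] := strips D D_in.
have [j [s [DE run]]] := strip_seg le_paths (sub_C D_in)
  (fun b c bD cD => conf_same_row D_in bD cD) D_strip.
exists j, s, (s + (l.*2 + l'))%N, l'; split=> // lt_y.
apply/eqP; rewrite -leqn0 leqNgt; apply/negP => l'_gt0.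
have [_ lenD] := strip_lengthP D_strip.
have := r0 D D_in; rewrite lenD /= l'_gt0 /= => /forall_inP/(_ _ _)/eqP anchor.
have [/andP[s_gt0 s_le] le_N ge_run _] := run.
have [||b [b_reg cb rb]] := @row_ex (s + (l.*2 + l'))%N j; first by lia.
  by have [] := ge_run (s + (l.*2 + l'))%N; lia.
have : column b = N.
  apply: anchor; rewrite /rightmost DE in_seg b_reg rb eqxx cb leqnn s_le /=.
  by apply/forall_inP => c; rewrite in_seg => /and3P[_ _ /andP[]].
by rewrite cb; lia.
Qed.

Lemma conf_seg_of b : b \in reg ->
  exists s y l', [/\ pblock C b = seg (row_of b) s y, ballot_run (row_of b) s y l',
                    (y < N)%N -> l' = 0%N & (s <= column b <= y)%N].
Proof.
move=> b_reg; have [j [s [y [l' [DE run l'0]]]]] := conf_seg (pb_in b_reg).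
have := own b_reg; rewrite {1}DE in_seg => /and3P[_ /eqP rb b_in].
by exists s, y, l'; rewrite rb.
Qed.

Definition linked (x j : nat) : bool :=
  [exists b in reg, [&& column b == x, row_of b == j
                      & [exists c in pblock C b, column c == x.+1]]].

Lemma linkedP b s y l' : b \in reg ->
  pblock C b = seg (row_of b) s y -> ballot_run (row_of b) s y l' ->
  linked (column b) (row_of b) = (column b < y)%N.
Proof.
move=> b_reg DE [/andP[s_gt0 _] le_N ge_run _].
have := own b_reg; rewrite {1}DE in_seg => /and3P[_ _ /andP[le_s le_y]].
apply/exists_inP/idP => [[b' b'_reg]|lt_y].
  case/and3P=> /eqP cb' /eqP rb' /exists_inP[c cD /eqP cc].
  have eb : b' = b by apply: (row_inj le_paths).
  by move: cD; rewrite eb DE in_seg cc => /and3P[_ _ /andP[]].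
exists b => //; rewrite !eqxx; apply/exists_inP.
have [||c [c_reg cc rc]] := @row_ex (column b).+1 (row_of b); first by lia.
  by have [] := ge_run (column b).+1; lia.
by exists c; rewrite ?cc // DE in_seg c_reg rc eqxx cc; lia.
Qed.

Lemma linked_rows x j : linked x j -> (j < nrows x)%N /\ (j < nrows x.+1)%N.
Proof.
case/exists_inP=> b b_reg /and3P[/eqP <- /eqP <- /exists_inP[c cD /eqP <-]].
have [lt_b _] := regP le_paths b_reg; split=> //.
rewrite (conf_same_row (pb_in b_reg) (own b_reg) cD).
by have [] := regP le_paths (subsetP (sub_C (pb_in b_reg)) _ cD).
Qed.

(** The neighbours towards the base of two boxes of one strip share a strip. Hence the linked rows
    form an initial segment, and their number describes them. *)
Lemma linked_pred x j : linked x j.+1 -> linked x j.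
Proof.
case/exists_inP=> b b_reg /and3P[/eqP cb /eqP rb /exists_inP[c cD /eqP cc]].
have [u [u_reg cu ru]] := next_row b_reg rb.
have [|v [vE cv rv]] := closed_row_rel (pb_in b_reg) (own b_reg) cD u_reg cu.
  by rewrite rb ru.
apply/exists_inP; exists u => //; rewrite cu cb ru !eqxx /=.
by apply/exists_inP; exists v; rewrite // cv cc.
Qed.

Definition link_count (x : nat) : nat :=
  find (fun j => ~~ linked x j) (iota 0 (nrows x)).

Lemma link_count_le x : (link_count x <= nrows x)%N.
Proof. by rewrite -[X in (_ <= X)%N](size_iota 0) find_size. Qed.

Lemma lt_link_count x j : (j < link_count x)%N = linked x j.
Proof.
apply/idP/idP => [lt_j|lk].
  have := before_find 0%N lt_j; rewrite nth_iota; last first.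
    by apply: leq_trans lt_j (link_count_le x).
  by rewrite add0n => /negbFE.
rewrite ltnNge; apply/negP => le_j.
have lk' k : (k <= j)%N -> linked x (j - k).
  elim: k => [|k IH] lt_k; first by rewrite subn0.
  by apply: linked_pred; rewrite -subSn // subSS IH // ltnW.
have [lt_r _] := linked_rows lk.
have has_f : has (fun j => ~~ linked x j) (iota 0 (nrows x)).
  by rewrite has_find size_iota; apply: leq_ltn_trans le_j lt_r.
have := nth_find 0%N has_f; rewrite -/(link_count x) nth_iota ?add0n; last first.
  exact: leq_ltn_trans le_j lt_r.
by rewrite -(subKn le_j) lk' // leq_subr.
Qed.

Lemma link_count_le1 x : (link_count x <= nrows x.+1)%N.
Proof.
case E: (link_count x) => [//|k]; have : (k < link_count x)%N by rewrite E.
by rewrite lt_link_count => /linked_rows[].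
Qed.

Definition conf_run : seq nat := mkseq link_count N.

Notation run_col := (run_column Y p q conf_run).
Notation entry := (row_entry Y p q conf_run).

(** Induction on columns: the state rebuilt from the link counts records for every box the true
    first column of its strip and its true excess. *)
Let conf_entries x : (x <= N)%N ->
  size (run_col x) = nrows x /\
  forall b, b \in reg -> column b = x ->
    exists y l', let s := (entry x (row_of b)).1 in
    [/\ pblock C b = seg (row_of b) s y, ballot_run (row_of b) s y l',
        (y < N)%N -> l' = 0%N &
        ((ups_to p x).*2 + s = (ups_to p s).*2 + x + (entry x (row_of b)).2)%N].
Proof.
elim: x => [|x IH] lt_x.
  split; first by rewrite /row_count /ups_to !take0.
  by move=> b _ cb.
have [sz inv] := IH (ltnW lt_x).
have colS : run_col x.+1 = step x.+1 (dir x) (nrows x.+1) (link_count x) (run_col x).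
  by rewrite /run_column run_stateS ?size_tuple ?size_mkseq // nth_mkseq // sz nrowsS.
have le_r : (link_count x <= size (run_col x))%N by rewrite sz link_count_le.
split; first by rewrite colS size_step // link_count_le1.
move=> c c_reg cc; have [lt_c _] := regP le_paths c_reg; rewrite cc in lt_c.
have eE : entry x.+1 (row_of c) = if (row_of c < link_count x)%N
    then bump_row (dir x) (entry x (row_of c)) else (x.+1, 0%N).
  by rewrite /row_entry colS nth_step.
case: ifP eE => lt_r ->.
  have := lt_r; rewrite lt_link_count => /exists_inP[b b_reg].
  case/and3P=> /eqP cb /eqP rb /exists_inP[c' c'D /eqP cc'].
  have rc' := conf_same_row (pb_in b_reg) c'D (own b_reg).
  have ec : c' = c.
    apply: (row_inj le_paths) => //; last by rewrite rc' rb.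
      exact: (subsetP (sub_C (pb_in b_reg))).
    by rewrite cc' cc.
  rewrite {c' cc' rc'}ec in c'D.
  have [y [l' [DE run l'0 endE]]] := inv b b_reg cb; rewrite rb in DE run endE.
  exists y, l'; rewrite /= (pb_id (pb_in b_reg) c'D); split=> //.
  (* The strip stays above its start in column [x.+1], so the predecessor taken on a down step is
     not truncated. *)
  have [_ _ ge_run _] := run; have := c'D; rewrite DE in_seg cc => /and3P[_ _ in_y].
  have [_] := ge_run x.+1 in_y; rewrite ups_toS ?size_tuple //.
  by case: (dir x) => /=; lia.
have [s [y [l' [DE run l'0 s_in]]]] := conf_seg_of c_reg.
have sx : s = x.+1.
  apply/eqP; rewrite eqn_leq -{1}cc; case/andP: (s_in) => -> le_y /=.
  rewrite leqNgt; apply/negP; rewrite ltnS => le_s.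
  have [/andP[s_gt0 _] le_N ge_run _] := run.
  have [||b [b_reg cb rb]] := @row_ex x (row_of c); first by lia.
    by have [] := ge_run x; lia.
  have bD : b \in pblock C c by rewrite DE in_seg b_reg rb eqxx cb; lia.
  move/negP: lt_r; apply; rewrite lt_link_count -rb -cb.
  rewrite (@linkedP _ s y l') //; rewrite ?rb ?(pb_id (pb_in c_reg) bD) //; lia.
exists y, l'; rewrite /= -sx; split=> //; lia.
Qed.

Hypothesis counts_C : forall x, (x < N)%N ->
  link_count x \in link_counts Y (dir x) (nth false q x) (nrows x).

Lemma conf_run_valid : conf_run \in runs Y 0 [::] p q.
Proof.
apply/runsP; first by rewrite !size_tuple.
rewrite size_mkseq size_tuple; split=> // x lt_x S'.
have -> : S' = run_col x by [].
rewrite nth_mkseq //; have [sz inv] := conf_entries (ltnW lt_x).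
rewrite sz; split; first exact: counts_C.
have box_at j : (j < nrows x)%N -> exists b, [/\ b \in reg, column b = x & row_of b = j].
  move=> lt_j; apply: row_ex => //; rewrite (ltnW lt_x) andbT lt0n.
  by apply/eqP => x0; move: lt_j; rewrite x0 /nrows /ups_to !take0.
rewrite /row_ok; apply/andP; split.
  apply/(all_nthP (0, 0)%N) => i; rewrite size_drop sz nth_drop => lt_i.
  have lt_j : (link_count x + i < nrows x)%N by lia.
  have [b [b_reg cb rb]] := box_at _ lt_j.
  have [y [l' /= [DE run l'0 endE]]] := inv b b_reg cb.
  have := linkedP b_reg DE run; rewrite cb rb -lt_link_count ltnNge leq_addr /=.
  have := own b_reg; rewrite {1}DE in_seg cb => /and3P[_ _ /andP[_ le_y]].
  move/esym/negbT; rewrite -leqNgt => le_yx.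
  have [_ _ _ endE'] := run; have {le_y le_yx} yx : y = x by lia.
  by rewrite /closed_row -/(entry x _) -rb; rewrite yx l'0 ?yx // in endE'; lia.
have [//|down] := boolP (dir x).
apply/(all_nthP (0, 0)%N) => j; rewrite size_takel ?sz ?link_count_le // => lt_j.
rewrite nth_take // /predC /= /closed_row -/(entry x j) -lt0n.
have [b [b_reg cb rb]] := box_at j (leq_trans lt_j (link_count_le x)).
have [y [l' /= [DE run l'0 endE]]] := inv b b_reg cb.
have := linkedP b_reg DE run; rewrite cb rb -lt_link_count lt_j => /esym lt_y.
have [/andP[s_gt0 _] _ ge_run _] := run; have := own b_reg.
rewrite {1}DE in_seg cb => /and3P[_ _ /andP[le_s _]].
have [|_] := ge_run x.+1; first by lia.
by rewrite ups_toS ?size_tuple // (negbTE down); rewrite rb in le_s endE *; lia.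
Qed.

Lemma start_in_seg j s y l' :
  ballot_run j s y l' ->
  exists b, [/\ b \in reg, column b = s, row_of b = j & b \in seg j s y].
Proof.
case=> /andP[s_gt0 s_le] le_N ge_run _.
have [||b [b_reg cb rb]] := @row_ex s j; first by lia.
  by have [] := ge_run s; lia.
by exists b; rewrite in_seg b_reg cb rb eqxx leqnn s_le.
Qed.

Lemma conf_run_eq : C = run_conf Y p q conf_run.
Proof.
rewrite -[LHS](equivalence_partition_pblock part_C).
apply: eq_in_imset => b b_reg; apply/setP => c; rewrite [LHS]in_set [RHS]in_set.
case c_reg: (c \in reg) => //=.
have [_ /(_ b b_reg erefl)[y [l' /= [DE run _ _]]]] := conf_entries (column_le b).
have [_ /(_ c c_reg erefl)[y2 [l2 /= [DE2 run2 _ _]]]] := conf_entries (column_le c).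
rewrite /key xpair_eqE; apply/idP/andP => [cD|[/eqP er /eqP es]].
  have eD := pb_id (pb_in b_reg) cD.
  have er := conf_same_row (pb_in b_reg) (own b_reg) cD; split; first exact/eqP.
  have [u [_ cu _ uD]] := start_in_seg run; have [v [_ cv _ vD]] := start_in_seg run2.
  move: uD vD; rewrite -DE -eD DE2 in_seg cu => /and3P[_ _ /andP[le1 _]].
  rewrite -DE2 eD DE in_seg cv => /and3P[_ _ /andP[le2 _]].
  by rewrite eqn_leq le1 le2.
have [u [u_reg cu ru uD]] := start_in_seg run.
have [v [v_reg cv rv vD]] := start_in_seg run2.
have uv : u = v by apply: (row_inj le_paths); rewrite ?cu ?cv ?ru ?rv.
rewrite -DE in uD; rewrite -DE2 -uv in vD.
by rewrite -(pb_id (pb_in b_reg) uD) (pb_id (pb_in c_reg) vD) own.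
Qed.
End ConfRun.

(** * From Rules I(a) and II(a) to link counts *)

Section Rules.
Variables (N : nat) (p q : word N) (C : {set {set box N}}).

Lemma closed_ruleIa :
  ruleIa C ->
  forall D D' b c, D \in C -> D' \in C -> b \in D' -> c \in D' ->
    has_pos D (towards_base RuleI (centre b)) ->
    has_pos D (towards_base RuleI (centre c)).
Proof.
move=> Ia D D' b c D_in D'_in bD' cD' hb.
have /forall_inP/(_ D' D'_in)/implyP := forall_inP Ia D D_in.
by move=> H; apply: (forall_inP (H _)) cD'; apply/exists_inP; exists b.
Qed.

Lemma conf_runI :
  Defs.path_le p q -> is_conf p q C -> ruleIa C ->
  exists2 rs, rs \in runs RuleI 0 [::] p q & C = run_conf RuleI p q rs.
Proof.
move=> le_pq conf_C Ia.
have cl := closed_ruleIa Ia; have valid := @conf_run_valid N RuleI p q C.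
have eqC := @conf_run_eq N RuleI p q C.
exists (conf_run RuleI p q C); last exact: eqC.
apply: valid => // x lt_x; rewrite /link_counts mem_index_iota /=.
have le1 := @link_count_le N RuleI p q C x.
have le2 := link_count_le1 (Y := RuleI) le_pq conf_C cl x.
have := @nrowsS N RuleI p q x le_pq lt_x; rewrite /next_size.
have := elimT (path_leP _ _) le_pq x (ltnW lt_x).
have := elimT (path_leP _ _) le_pq x.+1 lt_x.
rewrite /row_count /lower /upper_path !ups_toS ?size_tuple // in le1 le2 *.
by case: (nth false p x) le2; case: (nth false q x) => /=; lia.
Qed.

Lemma towards_base_self (D : {set box N}) b Y :
  is_strip D -> b \in D -> ~~ has_pos D (towards_base Y (centre b)).
Proof.
move=> D_strip bD; apply/negP.
have -> : towards_base Y (centre b) =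
    ((column b)%:Z, if Y is RuleI then level b - 2 else level b + 2).
  by case: Y.
move=> /has_posP[u uD [cu lu]]; have cub : column u = column b by lia.
by move: lu; rewrite (strip_column_inj D_strip uD bD cub); case: Y; lia.
Qed.

Hypotheses (le_qp : Defs.path_le q p) (conf_C : is_conf q p C) (IIa : ruleIIa C).

Let strip_C D : D \in C -> is_strip D.
Proof. by case/and3P: conf_C => _ /forall_inP strips _; exact: strips. Qed.

Lemma ruleIIaP D D' b c z z' :
  D \in C -> D' \in C -> D' != D -> b \in D -> z \in upper (centre b) ->
  has_pos D' z -> c \in D -> z' \in upper (centre c) -> z'.1 <= N%:Z ->
  has_pos D z' || has_pos D' z'.
Proof.
move=> D_in D'_in neq bD z_in z_D' cD z'_in le_z'.
have /forall_inP/(_ D' D'_in)/implyP/(_ neq)/implyP H := forall_inP IIa D D_in.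
have touch : [exists b in D, has (has_pos D') (upper (centre b))].
  by apply/exists_inP; exists b => //; apply/hasP; exists z.
exact: implyP (allP (forall_inP (H touch) c cD) z' z'_in) le_z'.
Qed.

(** A strip has one box per column, so the position above [c] is not in [D'] itself, and Rule II(a)
    leaves only [D]. *)
Lemma closed_ruleIIa D D' b c :
  D \in C -> D' \in C -> b \in D' -> c \in D' ->
  has_pos D (towards_base RuleII (centre b)) ->
  has_pos D (towards_base RuleII (centre c)).
Proof.
move=> D_in D'_in bD' cD' hb; have neq : D != D'.
  by apply: contraTneq hb => ->; apply: towards_base_self; rewrite ?strip_C.
have up_in (u : box N) : towards_base RuleII (centre u) \in upper (centre u).
  by rewrite inE eqxx.
have := ruleIIaP D'_in D_in neq bD' (up_in b) hb cD' (up_in c).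
rewrite (negbTE (@towards_base_self D' c RuleII (strip_C D'_in) cD')) /=.
by apply; rewrite /= lez_nat column_le.
Qed.

Notation reg := (reg RuleII p q).
Notation nrows := (row_count RuleII p q).
Notation row_of := (row_of p).
Notation link_count := (link_count RuleII p q C).
Let row_ex := @row_exists N RuleII p q le_qp.
Let cl := closed_ruleIIa.

(* By Rule IIa a position NE or NW of a strip, in the row of the strip, belongs
   to the strip: otherwise the strip at that position would also contain the
   position just above, which lies in another row. *)
Lemma ruleII_neighbour b v :
  b \in reg -> v \in reg -> row_of b = row_of v ->
  centre v \in upper (centre b) -> v \in pblock C b.
Proof.
have [part_C _ _] := and3P conf_C.
have [_ tI _] := and3P part_C; have cov := cover_partition part_C.
move=> b_reg v_reg rbv v_up; apply/negPn/negP => v_out.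
have own u : u \in reg -> u \in pblock C u by move=> u_reg; rewrite mem_pblock cov.
have pb_in u : u \in reg -> pblock C u \in C by move=> u_reg; rewrite pblock_mem // cov.
have neq : pblock C v != pblock C b by apply: contraNneq v_out => <-; exact: own.
have vv : has_pos (pblock C v) (centre v) by apply/has_posP; exists v; rewrite ?own.
have up_in : towards_base RuleII (centre b) \in upper (centre b) by rewrite inE eqxx.
have := ruleIIaP (pb_in b b_reg) (pb_in v v_reg) neq (own b b_reg) v_up vv
  (own b b_reg) up_in.
rewrite (negbTE (towards_base_self RuleII (strip_C (pb_in b b_reg)) (own b b_reg))).
rewrite /=.
rewrite lez_nat column_le => /(_ isT) hu.
have sub : pblock C v \subset reg.
  apply/subsetP => u uD; rewrite -[reg]cov; apply/bigcupP.
  by exists (pblock C v); rewrite ?pb_in.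
have [u uD [_ ru]] := elimT (has_pos_towards_base (Y := RuleII) le_qp sub b_reg) hu.
have := conf_same_row (Y := RuleII) le_qp conf_C cl (pb_in v v_reg) uD (own v v_reg).
by rewrite -rbv ru; lia.
Qed.

Let height_p x : (x <= N)%N -> height p x = (ups_to p x).*2%:Z - x%:Z.
Proof. by move=> le_x; rewrite heightE ?size_tuple. Qed.

Lemma conf_runII :
  exists2 rs, rs \in runs RuleII 0 [::] p q & C = run_conf RuleII p q rs.
Proof.
have valid := @conf_run_valid N RuleII p q C.
have eqC := @conf_run_eq N RuleII p q C.
exists (conf_run RuleII p q C); last exact: eqC.
apply: valid => // x lt_x.
have hp := height_p (ltnW lt_x); have hp1 := height_p lt_x.
have nS := @nrowsS N RuleII p q x le_qp lt_x; rewrite /next_size in nS.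
have := elimT (path_leP _ _) le_qp x (ltnW lt_x).
have := elimT (path_leP _ _) le_qp x.+1 lt_x.
have upS := @ups_toS p x; rewrite size_tuple in upS; have {}upS := upS lt_x.
have le1 := @link_count_le N RuleII p q C x.
have le2 := link_count_le1 (Y := RuleII) le_qp conf_C cl x.
rewrite !ups_toS ?size_tuple // => le_u1 le_u.
have nrows0 : nrows 0 = 0%N by rewrite /row_count /ups_to !take0.
have x_gt0 : (0 < nrows x)%N -> (0 < x)%N.
  by case: (posnP x) => // ->; rewrite nrows0.
have lk j : (j < nrows x)%N -> (j < nrows x.+1)%N -> (j < link_count x)%N.
  move=> lt_j lt_j1; rewrite (lt_link_count (Y := RuleII) le_qp conf_C cl).
  have [||b [b_reg cb rb]] := @row_ex x j; [by rewrite x_gt0; lia | by [] |].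
  have [||v [v_reg cv rv]] := @row_ex x.+1 j; [by [] | by [] |].
  have [_ lb] := @regP N RuleII p q le_qp b b_reg.
  have [_ lv] := @regP N RuleII p q le_qp v v_reg.
  rewrite cb rb cv rv /row_level in lb lv.
  have same : v \in pblock C b.
    (* If the base path goes up, the right box is NE of the left one; if it goes down, the left box
       is NW of the right one. *)
    have [up|down] := boolP (nth false p x).
      apply: ruleII_neighbour => //; first by rewrite rb.
      have -> : centre v = NE (centre b).
        by rewrite /centre /NE /= cb cv lb lv; congr (_, _); lia.
      by rewrite !inE eqxx !orbT.
    suff bv : b \in pblock C v.
      have part_C : partition C reg by case/and3P: conf_C.
      have [_ tI _] := and3P part_C; have cov := cover_partition part_C.
      by rewrite (same_pblock tI bv) mem_pblock cov.
    apply: ruleII_neighbour => //; first by rewrite rb.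
    have -> : centre b = NW (centre v).
      by rewrite /centre /NW /= cb cv lb lv; congr (_, _); lia.
    by rewrite !inE eqxx !orbT.
  apply/exists_inP; exists b => //; rewrite cb rb !eqxx /=.
  by apply/exists_inP; exists v; rewrite // cv.
rewrite /link_counts; case: ifP => up.
  rewrite inE eqn_leq le1 /= leqNgt; apply/negP => lt_l.
  have /lk := lt_l; rewrite ltnn => /(_ _)/negPf; rewrite up in nS; lia.
rewrite up in nS; have le_q : (nth false q x <= nrows x)%N.
  rewrite /row_count /lower /upper_path; rewrite up /= in upS le_u1.
  by move: le_u1; case: (nth _ q x) => /=; lia.
rewrite le_q inE; apply/eqP.
have lt_absurd : ~~ (link_count x < nrows x.+1)%N.
  by apply/negP => lt_l; have := lk _ _ lt_l; rewrite ltnn => /(_ _)/negPf; lia.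
lia.
Qed.
End Rules.

(** * The generating functions *)

Lemma eq_genfun (R : comNzRingType) (t : R) Y e F G x S ps qs :
  F =1 G -> genfun t Y e F x S ps qs = genfun t Y e G x S ps qs.
Proof.
move=> eFG; elim: ps qs x S => [|p ps IH] [|q qs] x S //=.
by apply: eq_transfer => U; exact: IH.
Qed.

Lemma area_nrows N Y (p q : word N) :
  Defs.path_le (lower Y p q) (upper_path Y p q) ->
  area Y 0 p q = (\sum_(x < N) row_count Y p q x.+1)%N.
Proof.
move=> le_pq; rewrite -(big_mkord xpredT (fun x => row_count Y p q x.+1)).
have H k : (k <= N)%N ->
    area Y (row_count Y p q (N - k)) (drop (N - k) p) (drop (N - k) q)
    = (\sum_(N - k <= x < N) row_count Y p q x.+1)%N.
  elim: k => [|k IH] lt_k.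
    by rewrite subn0 big_geq // !drop_oversize ?size_tuple.
  have lt_N : (N - k.+1 < N)%N by lia.
  have dropE (s : word N) :
      drop (N - k.+1) s = nth false s (N - k.+1) :: drop (N - k.+1).+1 s.
    by rewrite (drop_nth false) ?size_tuple.
  rewrite big_ltn // !dropE /= nrowsS //.
  have -> : (N - k.+1).+1 = (N - k)%N by lia.
  by rewrite IH // ltnW.
have := H N (leqnn N); rewrite subnn !drop0 => <-.
by rewrite /row_count /ups_to !take0.
Qed.

Lemma card_diagram N (a : word N) : #|diagram a| = (\sum_(x < N) ups_to a x.+1)%N.
Proof.
(* Above the path of 1's only, the whole diagram is a region, so boxes can be counted by rows. *)
pose bot : word N := [tuple of nseq N false].
have ups0 x : ups_to bot x = 0%N.
  apply/eqP; rewrite -leqn0 leqNgt -has_count; apply/hasPn => b /mem_take.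
  by rewrite /= mem_nseq => /andP[_ /eqP->].
have le_a : Defs.path_le (lower RuleI bot a) (upper_path RuleI bot a).
  by apply/path_leP => x _; rewrite ups0.
have -> : diagram a = reg RuleI bot a.
  rewrite /reg /region; suff -> : diagram (lower RuleI bot a) = set0 by rewrite setD0.
  apply/setP => b; rewrite !inE; apply/negP => /and3P[le_b _].
  by rewrite heightE ?size_tuple ?column_le // ups0; lia.
rewrite -sum1_card (partition_big (fun b : box N => b.1) xpredT) //=.
apply: eq_bigr => x _.
rewrite (eq_bigl (fun b => (b \in reg RuleI bot a) && (column b == x.+1))); last first.
  by move=> b; rewrite /column eqSS.
rewrite (big_column _ (fun=> 1%N) le_a) ?ltn_ord // sum1_size size_iota.
by rewrite /row_count ups0 subn0.
Qed.

Section Assembly.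
Variables (R : comNzRingType) (t tN : R) (X : parameter_case) (N : nat).
Hypotheses (X_ok : admissible t tN X) (N_gt0 : (0 < N)%N).

Definition run_ok (Y : rule) (S : state) : bool :=
  if Y is RuleI then even_ok X S else chain_ok X (map snd S).

Lemma mem_Conf Y (p q : word N) C :
  Defs.path_le (lower Y p q) (upper_path Y p q) ->
  reflect (exists rs, [/\ rs \in runs Y 0 [::] p q, run_ok Y (run_column Y p q rs N)
                        & C = run_conf Y p q rs])
          (C \in Conf X Y (lower Y p q) (upper_path Y p q)).
Proof.
move=> le_pq; rewrite inE; apply: (iffP andP) => [[conf_C rule_C]|].
  have [rs rs_v eC] : exists2 rs, rs \in runs Y 0 [::] p q & C = run_conf Y p q rs.
    case: (Y) le_pq conf_C rule_C => le_pq conf_C rule_C.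
      by apply: conf_runI => //; move: rule_C; rewrite /=; case: (X) => // m /andP[].
    by apply: conf_runII => //; move: rule_C; rewrite /=; case: (X) => // m /andP[].
  exists rs; split=> //; move: rule_C; rewrite eC /run_ok.
  case: (Y) rs_v => rs_v; rewrite /=; case: (X) X_ok => // m [m_gt0 _] /andP[_].
    by rewrite ruleIb_run.
  by rewrite ruleIIb_run.
case=> rs [rs_v ok ->]; split; first exact: run_conf_is_conf.
move: ok; rewrite /run_ok; case: (Y) rs_v => rs_v.
  rewrite /=; have Ia := ruleIa_run rs_v N_gt0 erefl.
  by case: (X) X_ok => // m [m_gt0 _]; rewrite Ia ruleIb_run.
rewrite /=; have IIa := ruleIIa_run rs_v N_gt0.
by case: (X) X_ok => // m [m_gt0 _]; rewrite IIa ruleIIb_run.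
Qed.

Lemma genfun_Q Y e (p q : word N) :
  genfun t Y e (closing t tN X Y) 0 [::] p q =
  e ^+ area Y 0 p q * Q t tN X Y (lower Y p q) (upper_path Y p q).
Proof.
rewrite genfun_runs /=; congr (_ * _); rewrite /Q; case: ifP => le_pq; last first.
  (* Incomparable paths admit no valid run, in agreement with the value 0 of [Q]. *)
  by rewrite big_seq big1 // => rs /valid_path_le; rewrite le_pq.
rewrite -big_enum /=.
pose L := [seq run_conf Y p q rs | rs <- runs Y 0 [::] p q
                                 & run_ok Y (run_column Y p q rs N)].
rewrite (perm_big L) /=; last first.
  apply: uniq_perm; first exact: enum_uniq.
    rewrite map_inj_in_uniq ?filter_uniq ?uniq_runs // => rs rs'.
    rewrite !mem_filter => /andP[_ rs_v] /andP[_ rs'_v].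
    exact: run_conf_inj.
  move=> C; rewrite mem_enum; apply/(mem_Conf _ le_pq)/mapP.
    by case=> rs [rs_v ok ->]; exists rs; rewrite ?mem_filter ?ok.
  by case=> rs; rewrite mem_filter => /andP[ok rs_v] ->; exists rs.
rewrite big_map big_filter [RHS]big_mkcond !big_seq; apply: eq_bigr => rs rs_v.
rewrite size_tuple -/(run_column Y p q rs N) (prod_run_conf rs_v N_gt0) //.
have -> : closing t tN X Y (run_column Y p q rs N) = (run_ok Y (run_column Y p q rs N))%:R
    * \prod_(i <- run_column Y p q rs N) anchor_wt t tN X Y i.2.
  by rewrite /closing /run_ok; case: (Y).
by case: run_ok; rewrite ?mul1r // mul0r mulr0.
Qed.

End Assembly.

Theorem theorem10 (R : comNzRingType) (t tN : R) (X : parameter_case)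
    (hX : admissible t tN X) (N : nat) (hN : (1 <= N)%N) (a c : word N) :
  \sum_(b : word N)
     Q t tN X RuleI a b * Q t tN X RuleII b c
       * (-1) ^+ (#|diagram b| + #|diagram c|)
  = (a == c)%:R.
Proof.
have good0 : good_shift X 0.
  by case: X hX => // m [m_gt0 _] /=; rewrite leqNgt m_gt0.
rewrite -(duality t tN 0 0 good0 (size_tuple a) (size_tuple c)) -big_words_tuple.
apply: eq_bigr => b _.
have shift0 S : shift 0 S = S.
  by rewrite /shift -[RHS]map_id; apply: eq_map => -[x v]; rewrite addn0.
rewrite (@eq_genfun _ _ RuleI _ _ (closing t tN X RuleI)); last first.
  by move=> S; rewrite /closingI shift0.
rewrite (@eq_genfun _ _ RuleII _ _ (closing t tN X RuleII)); last first.
  by move=> S; rewrite /closingII mul0n mul1r shift0.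
rewrite !(@genfun_Q R t tN X N hX hN) expr1n mul1r /= -mulrA.
congr (_ * _); rewrite mulrC.
rewrite /Q; case: ifP => le_bc; last by rewrite !mulr0.
congr (_ * _); rewrite (@area_nrows N RuleII c b le_bc) !card_diagram.
rewrite -signr_odd -[RHS]signr_odd; congr (_ ^+ nat_of_bool _).
(* The transfer produces the sign of |c| - |b|, which has the parity of |b| + |c|. *)
have -> : (\sum_(x < N) ups_to c x.+1 =
    \sum_(x < N) row_count RuleII c b x.+1 + \sum_(x < N) ups_to b x.+1)%N.
  rewrite -big_split; apply: eq_bigr => x _ /=.
  by rewrite /row_count /lower /upper_path subnK // (elimT (path_leP _ _) le_bc).
by rewrite addnCA oddD addnn odd_double addbF.
Qed.
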